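(* Let $(P,\rhd,\lhd)$ be a Zinbiel-dendriform algebra, $(Q=\bigoplus_{i\in\mathbb Z}Q_i,\circ,\varpi)$ a quadratic $\mathbb Z$-graded Leibniz algebra, and $(P\otimes Q,\cdot)$ the $\mathbb Z$-graded pre-Lie algebra with $$(a\otimes x)\cdot(b\otimes y)=(a\rhd b)\otimes (x\circ y)-(b\lhd a)\otimes (y\circ x).$$ Let $\{e_j\}_{j\in\Omega}$ be a homogeneous basis of $Q$ and $\{f_j\}_{j\in\Omega}$ its homogeneous dual basis with respect to $\varpi$. (i) Suppose $r=\sum_iu_i\otimes v_i\in P\otimes P$ is a solution of the ZD-YBE in $(P,\rhd,\lhd)$ with $r+\tau(r)$ invariant in $P\otimes P$. Then $$\hat r=\sum_i\sum_{j\in\Omega}(u_i\otimes e_j)\otimes(v_i\otimes f_j)\in(P\otimes Q)\hat\otimes(P\otimes Q)$$ is a completed solution of the $S$-equation in $(P\otimes Q,\cdot)$ and $\hat r-\hat\tau(\hat r)$ is invariant in $(P\otimes Q)\hat\otimes(P\otimes Q)$. In particular, if $r$ is a skew-symmetric solution of the ZD-YBE, then $\hat r$ is a symmetric completed solution of the $S$-equation. (ii) Furthermore, let $(Q,\circ,\varpi)$ be the quadratic $\mathbb Z$-graded Leibniz algebra $Q=W\otimes\mathbb K[t,t^{-1}]=\bigoplus_{n}W\otimes t^n$, $(x\otimes t^m)\circ(y\otimes t^n)=(x\circ y)\otimes t^{m+n}$, $\varpi(x\otimes t^m,y\otimes t^n)=\nu(x,y)\delta_{m+n,0}$, where $W$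 has basis $\varepsilon_1,\dots,\varepsilon_4$ with nonzero products $\varepsilon_2\circ\varepsilon_1=\varepsilon_1$, $\varepsilon_2\circ\varepsilon_2=\varepsilon_1$, $\varepsilon_2\circ\varepsilon_3=-\varepsilon_3-\varepsilon_4$, $\varepsilon_3\circ\varepsilon_1=\varepsilon_4$, $\varepsilon_3\circ\varepsilon_2=\varepsilon_3+2\varepsilon_4$, and $\nu$ is skew-symmetric with $\nu(\varepsilon_1,\varepsilon_3)=\nu(\varepsilon_2,\varepsilon_4)=1$ and all other $\nu(\varepsilon_i,\varepsilon_j)$, $i<j$, zero. For $r=\sum_iu_i\otimes v_i\in P\otimes P$ put (with $\varepsilon_kt^m=\varepsilon_k\otimes t^m$) $$\hat r=\sum_{m\in\mathbb Z}\sum_i\Big((u_i\otimes\varepsilon_1t^m)\otimes(v_i\otimes\varepsilon_3t^{-m})+(u_i\otimes\varepsilon_2t^m)\otimes(v_i\otimes\varepsilon_4t^{-m})-(u_i\otimes\varepsilon_3t^m)\otimes(v_i\otimes\varepsilon_1t^{-m})-(u_i\otimes\varepsilon_4t^m)\otimes(v_i\otimes\varepsilon_2t^{-m})\Big).$$ Then $\hat r$ is a completed solution of the $S$-equation in $(P\otimes Q,\cdot)$ with $\hat r-\hat\tau(\hat r)$ invariant in $(P\otimes Q)\hat\otimes(P\otimes Q)$ if and only if $r$ is a solution of the ZD-YBE in $(P,\rhd,\lhd)$ with $r+\tau(r)$ invariant in $P\otimes P$. In particular, $\hat r$ is a symmetric completed solution of the $S$-equation in $(P\otimes Q,\cdot)$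 if and only if $r$ is a skew-symmetric solution of the ZD-YBE in $(P,\rhd,\lhd)$.
   Context: All vector spaces are over a field $\mathbb K$; $\tau$ is the flip, $I$ the identity. Algebras are finite-dimensional except $\mathbb Z$-graded ones. $L_\ast(a)b=a\ast b$, $R_\ast(a)b=b\ast a$. Completed tensor products: for $\mathbb Z$-graded $U=\bigoplus U_i$, $V=\bigoplus V_j$, $U\hat\otimes V:=\prod_{i,j}U_i\otimes V_j$ (similarly for three factors); linear maps and the flip ($\hat\tau$) are extended termwise to formal sums. $P$ is in degree $0$, $P\otimes Q=\bigoplus_iP\otimes Q_i$. Zinbiel-dendriform algebra: bilinear $\rhd,\lhd$ such that, with $x\ast y=x\rhd y+x\lhd y$: $x\rhd(y\rhd z)=(x\ast y+y\ast x)\rhd z$ and $x\rhd(z\lhd y)=z\lhd(x\ast y)=(x\rhd z)\lhd y+(z\lhd x)\lhd y$. Put $x\ominus y=x\rhd y+y\lhd x$, so $L_\ominus=L_\rhd+R_\lhd$. ZD-YBE for $r=\sum_iu_i\otimes v_i\in P\otimes P$: $r_{12}\ominus r_{23}-r_{13}\ast r_{23}+r_{13}\lhd r_{12}=0$, i.e. $\sum_{i,j}\big(u_i\otimes(v_i\ominus u_j)\otimes v_j-u_i\otimes u_j\otimes(v_i\ast v_j)+(u_i\lhd u_j)\otimes v_j\otimes v_i\big)=0$. $s\in P\otimes P$ is invariant if for all $m\in P$: $(I\otimes L_\ominus(m)-L_\ast(m)\otimes I)s=0$ and $(L_\rhd(m)\otimes I-I\otimes(L_\ast+R_\ast)(m))s=0$.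 Quadratic $\mathbb Z$-graded Leibniz algebra $(Q=\bigoplus Q_i,\circ,\varpi)$: each $Q_i$ is finite-dimensional, $Q_i\circ Q_j\subseteq Q_{i+j}$, $x\circ(y\circ z)=(x\circ y)\circ z+y\circ(x\circ z)$, and $\varpi$ is a non-degenerate skew-symmetric bilinear form, invariant ($\varpi(x\circ y,z)=\varpi(x,y\circ z+z\circ y)$) and graded (there is $m\in\mathbb Z$ with $\varpi(Q_i,Q_j)=0$ whenever $i+j+m\ne0$). Dual basis: $\varpi(e_i,f_j)=\delta_{ij}$. Pre-Lie algebra $(L,\cdot)$: $(x\cdot y)\cdot z-x\cdot(y\cdot z)=(y\cdot x)\cdot z-y\cdot(x\cdot z)$; $[x,y]=x\cdot y-y\cdot x$. For a $\mathbb Z$-graded pre-Lie algebra $L$, $\hat r=\sum_ia_i\otimes b_i\in L\hat\otimes L$ is a completed solution of the $S$-equation if $\hat r_{12}\cdot\hat r_{13}-\hat r_{12}\cdot\hat r_{23}-[\hat r_{13},\hat r_{23}]=0$, i.e. $\sum_{i,j}\big((a_i\cdot a_j)\otimes b_i\otimes b_j-a_i\otimes(b_i\cdot a_j)\otimes b_j-a_i\otimes a_j\otimes[b_i,b_j]\big)=0$ in $L\hat\otimes L\hat\otimes L$. $\hat s\in L\hat\otimes L$ is invariant if $\big(L_\cdot(x)\hat\otimes I+I\hat\otimes(L_\cdot(x)-R_\cdot(x))\big)\hat s=0$ for all $x\in L$. *)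

(* Defs.v *)
From HB Require Import structures.
From mathcomp Require Import all_boot all_order all_algebra.
From mathcomp Require Import all_classical ring.

Set Implicit Arguments.
Unset Strict Implicit.
Unset Printing Implicit Defensive.

Import Order.TTheory GRing.Theory Num.Theory.
Import VectorInternalTheory.

Local Open Scope classical_set_scope.
Local Open Scope ring_scope.

Notation bilinear_op f := (bilinear_for *:%R *:%R f).
Notation bilinear_form f := (bilinear_for *%R *%R f).

Section Bilinear.
Context {K : fieldType} {U V Z : lmodType K} (f : U -> V -> Z).
Hypothesis fB : bilinear_op f.

Lemma bilinDl u1 u2 v : f (u1 + u2) v = f u1 v + f u2 v.
Proof. by have := fB.1 v 1 u1 u2; rewrite /= !scale1r. Qed.
Lemma bilinDr u v1 v2 : f u (v1 + v2) = f u v1 + f u v2.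
Proof. by have := fB.2 u 1 v1 v2; rewrite /= !scale1r. Qed.
Lemma bilin0l v : f 0 v = 0.
Proof. by apply: (addrI (f 0 v)); rewrite -bilinDl !addr0. Qed.
Lemma bilin0r u : f u 0 = 0.
Proof. by apply: (addrI (f u 0)); rewrite -bilinDr !addr0. Qed.
Lemma bilinZl c u v : f (c *: u) v = c *: f u v.
Proof. by have := fB.1 v c u 0; rewrite /= bilin0l !addr0. Qed.
Lemma bilinZr c u v : f u (c *: v) = c *: f u v.
Proof. by have := fB.2 u c v 0; rewrite /= bilin0r !addr0. Qed.
Lemma bilinNl u v : f (- u) v = - f u v.
Proof. by rewrite -scaleN1r bilinZl scaleN1r. Qed.
Lemma bilinNr u v : f u (- v) = - f u v.
Proof. by rewrite -scaleN1r bilinZr scaleN1r. Qed.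
Lemma bilin_suml I (s : seq I) (Q : pred I) u v :
  f (\sum_(i <- s | Q i) u i) v = \sum_(i <- s | Q i) f (u i) v.
Proof. by apply: (big_morph (f^~ v)) => [x y|]; rewrite ?bilinDl ?bilin0l. Qed.
Lemma bilin_sumr I (s : seq I) (Q : pred I) u v :
  f u (\sum_(i <- s | Q i) v i) = \sum_(i <- s | Q i) f u (v i).
Proof. by apply: (big_morph (f u)) => [x y|]; rewrite ?bilinDr ?bilin0r. Qed.

End Bilinear.

Section Tensor.
Context {K : fieldType}.
Implicit Types U V W : vectType K.

(* The tensor product is realised in coordinates: [u ⊗ v] is the rank-one
   matrix of products of the coordinates of [u] and [v]. *)
Definition tens U V : vectType K := 'M[K]_(dim U, dim V).

Definition tpure U V (u : U) (v : V) : tens U V := (v2r u)^T *m v2r v.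

Definition tpure3 U V W (u : U) (v : V) (w : W) : tens U (tens V W) :=
  tpure u (tpure v w).

(* For bilinear [F], [tlift F] is the linear map on [U ⊗ V] with
   [tlift F (u ⊗ v) = F u v] (see [tlift_tpure]). *)
Definition tlift U V (Z : lmodType K) (F : U -> V -> Z) (A : tens U V) : Z :=
  \sum_(a < dim U) \sum_(b < dim V)
     A a b *: F (r2v (delta_mx 0 a)) (r2v (delta_mx 0 b)).

Definition tflip U V (A : tens U V) : tens V U := A^T.

Lemma v2r_basis U (u : U) :
  u = \sum_(a < dim U) v2r u 0 a *: r2v (delta_mx 0 a).
Proof.
apply: v2r_inj; rewrite linear_sum {1}[v2r u]row_sum_delta.
by apply: eq_bigr => a _; rewrite linearZ /= r2vK.
Qed.

Lemma tpureE U V (u : U) (v : V) a b : tpure u v a b = v2r u 0 a * v2r v 0 b.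
Proof. by rewrite mxE big_ord1 mxE. Qed.

Lemma tpure_bilinear U V : bilinear_op (@tpure U V).
Proof.
split=> w c x y; apply/matrixP=> a b;
  rewrite !(tpureE, mxE) linearP !mxE; first by rewrite mulrDl mulrA.
by rewrite mulrDr mulrCA.
Qed.

Lemma tlift_tpure U V (Z : lmodType K) (F : U -> V -> Z) :
  bilinear_op F -> forall u v, tlift F (tpure u v) = F u v.
Proof.
move=> [Fl Fr] u v.
pose lF (Z' : lmodType K) (T : vectType K) (G : T -> Z') (lG : linear G) :
    {linear T -> Z'} := HB.pack G (GRing.isLinear.Build K T Z' _ G lG).
rewrite -[RHS]/(lF _ _ _ (Fl v) u) [in RHS](v2r_basis u) linear_sum.
apply: eq_bigr => a _; rewrite linearZ /=.
rewrite -[X in _ = _ *: X]/(lF _ _ _ (Fr _) v) [in RHS](v2r_basis v) linear_sum.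
rewrite scaler_sumr; apply: eq_bigr => b _.
by rewrite linearZ /= scalerA tpureE.
Qed.

Lemma tlift_linear U V (Z : lmodType K) (F : U -> V -> Z) : linear (tlift F).
Proof.
move=> c A B; rewrite /tlift scaler_sumr -big_split; apply: eq_bigr => a _.
rewrite scaler_sumr -big_split; apply: eq_bigr => b _.
by rewrite /= !mxE scalerDl scalerA.
Qed.

Lemma tlift_sum U V (Z : lmodType K) (F : U -> V -> Z) I (s : seq I)
    (Q : pred I) A :
  tlift F (\sum_(i <- s | Q i) A i) = \sum_(i <- s | Q i) tlift F (A i).
Proof.
have l := tlift_linear F.
apply: (big_morph (tlift F)) => [x y|].
  by have := l 1 x y; rewrite !scale1r.
by have := l (-1) 0 0; rewrite scaler0 addr0 scaleN1r addNr.
Qed.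

Lemma tlift_fun_linear (T : lmodType K) U V (Z : lmodType K)
    (G : T -> U -> V -> Z) (A : tens U V) :
  (forall u v, linear (fun t => G t u v)) -> linear (fun t => tlift (G t) A).
Proof.
move=> lG c x y; rewrite /tlift scaler_sumr -big_split; apply: eq_bigr => a _.
rewrite scaler_sumr -big_split; apply: eq_bigr => b _.
by rewrite lG /= scalerDr !scalerA mulrC.
Qed.

Lemma linear_comp_add (T Z : lmodType K) (f g : T -> Z) :
  linear f -> linear g -> linear (fun t => f t + g t).
Proof. by move=> lf lg c x y; rewrite lf lg scalerDr addrACA. Qed.

Lemma linear_comp_opp (T Z : lmodType K) (f : T -> Z) :
  linear f -> linear (fun t => - f t).
Proof. by move=> lf c x y; rewrite lf opprD scalerN. Qed.

Lemma linear_comp (T Z Z' : lmodType K) (g : Z -> Z') (f : T -> Z) :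
  linear g -> linear f -> linear (fun t => g (f t)).
Proof. by move=> lg lf c x y; rewrite lf lg. Qed.

Lemma tflip_tpure U V (u : U) (v : V) : tflip (tpure u v) = tpure v u.
Proof. by rewrite /tflip trmx_mul trmxK. Qed.

Lemma tensE U V (A : tens U V) :
  A = \sum_(a < dim U) \sum_(b < dim V)
         A a b *: tpure (r2v (delta_mx 0 a)) (r2v (delta_mx 0 b)).
Proof.
rewrite {1}[A]matrix_sum_delta; apply: eq_bigr => a _; apply: eq_bigr => b _.
congr (_ *: _); apply/matrixP=> i j; rewrite tpureE !r2vK !mxE eqxx /=.
by rewrite -natrM mulnb.
Qed.

End Tensor.

Section DirectSum.
Context {K : fieldType}.
Variable V : int -> vectType K.

Record dsum := DSum {
  dval :> forall i, V i;
  dval_finite : finite_set [set i | dval i != 0] }.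

HB.instance Definition _ := gen_eqMixin dsum.
HB.instance Definition _ := gen_choiceMixin dsum.

Lemma dsumP (x y : dsum) : (forall i, x i = y i) -> x = y.
Proof.
case: x y => x xf [y yf] /= xy.
have {}xy : x = y by apply: functional_extensionality_dep.
by subst y; congr DSum; exact: Prop_irrelevance.
Qed.

Lemma dsum_zero_subproof : finite_set [set i | (0 : V i) != 0].
Proof. by apply: (sub_finite_set _ (finite_set0 _)) => i /=; rewrite eqxx. Qed.

Lemma dsum_add_subproof (x y : dsum) : finite_set [set i | x i + y i != 0].
Proof.
have := conj (dval_finite x) (dval_finite y).
rewrite -finite_setU; apply: sub_finite_set => i /=.
have [->|] := eqVneq (x i) 0; last by left.
by rewrite add0r; right.
Qed.

Lemma dsum_opp_subproof (x : dsum) : finite_set [set i | - x i != 0].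
Proof.
by apply: (sub_finite_set _ (dval_finite x)) => i /=; rewrite oppr_eq0.
Qed.

Lemma dsum_scale_subproof (c : K) (x : dsum) :
  finite_set [set i | c *: x i != 0].
Proof.
apply: (sub_finite_set _ (dval_finite x)) => i /=.
by apply: contra_neq => ->; rewrite scaler0.
Qed.

Definition dsum_zero := DSum dsum_zero_subproof.
Definition dsum_add x y := DSum (dsum_add_subproof x y).
Definition dsum_opp x := DSum (dsum_opp_subproof x).
Definition dsum_scale c x := DSum (dsum_scale_subproof c x).

Fact dsum_addA : associative dsum_add.
Proof. by move=> x y z; apply: dsumP => i; apply: addrA. Qed.
Fact dsum_addC : commutative dsum_add.
Proof. by move=> x y; apply: dsumP => i; apply: addrC. Qed.
Fact dsum_add0 : left_id dsum_zero dsum_add.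
Proof. by move=> x; apply: dsumP => i; apply: add0r. Qed.
Fact dsum_addN : left_inverse dsum_zero dsum_opp dsum_add.
Proof. by move=> x; apply: dsumP => i; apply: addNr. Qed.
HB.instance Definition _ :=
  GRing.isZmodule.Build dsum dsum_addA dsum_addC dsum_add0 dsum_addN.

Fact dsum_scaleA a b x :
  dsum_scale a (dsum_scale b x) = dsum_scale (a * b) x.
Proof. by apply: dsumP => i; apply: scalerA. Qed.
Fact dsum_scale1 : left_id 1 dsum_scale.
Proof. by move=> x; apply: dsumP => i; apply: scale1r. Qed.
Fact dsum_scaleDr : right_distributive dsum_scale +%R.
Proof. by move=> a x y; apply: dsumP => i; apply: scalerDr. Qed.
Fact dsum_scaleDl x : {morph dsum_scale^~ x : a b / a + b}.
Proof. by move=> a b; apply: dsumP => i; apply: scalerDl. Qed.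
HB.instance Definition _ := GRing.Zmodule_isLmodule.Build K dsum
  dsum_scaleA dsum_scale1 dsum_scaleDr dsum_scaleDl.

Lemma dinj_subproof i (x : V i) :
  finite_set [set j | eqtype.dfwith (fun j => 0 : V j) x j != 0].
Proof.
apply: (sub_finite_set _ (finite_set1 i)) => j /=.
by apply: contra_neqP => /eqP ji; rewrite eqtype.dfwith_out // eq_sym.
Qed.

Definition dinj i (x : V i) : dsum := DSum (dinj_subproof x).

Definition homogeneous (i : int) (x : dsum) := forall j, j != i -> x j = 0.

(* For bilinear [F i j], [dlift F] is the bilinear map on the direct sum with
   homogeneous components [F i j] (see [dlift_dinj]); the sums are finite. *)
Definition dlift (Z : lmodType K) (F : forall i j, V i -> V j -> Z)
    (x y : dsum) : Z :=
  \sum_(i \in [set: int]) \sum_(j \in [set: int]) F i j (x i) (y j).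

Lemma dlift_dinj (Z : lmodType K) (F : forall i j, V i -> V j -> Z) :
  (forall i j, bilinear_op (F i j)) ->
  forall i j (x : V i) (y : V j), dlift F (dinj x) (dinj y) = F i j x y.
Proof.
move=> bF i j x y; rewrite /dlift.
have F0l k l z : F k l 0 z = 0.
  by have := (bF k l).1 z (-1) 0 0; rewrite /= scaler0 addr0 scaleN1r addNr.
have F0r k l z : F k l z 0 = 0.
  by have := (bF k l).2 z (-1) 0 0; rewrite /= scaler0 addr0 scaleN1r addNr.
have ne k l (z : V k) : l != k -> dinj z l = 0.
  by move=> lk; rewrite /= eqtype.dfwith_out // eq_sym.
have eq k (z : V k) : dinj z k = z by rewrite /= eqtype.dfwith_in.
have single (T : choiceType) (G : T -> Z) (k : T) :
    (forall l, l != k -> G l = 0) -> \sum_(l \in [set: T]) G l = G k.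
  move=> G0; rewrite -(fsbig_widen [set k]) ?fsbig_set1 // => l [_ /= /eqP].
  exact: G0.
rewrite (single _ _ i) => [|k ki].
  by rewrite eq (single _ _ j) ?eq // => k kj; rewrite [X in F _ _ _ X]ne.
by rewrite fsbig1 // => l _; rewrite ne.
Qed.

Lemma dsum_support (x : dsum) :
  exists2 s : seq int, uniq s & forall i, i \notin s -> x i = 0.
Proof.
exists (finmap.enum_fset (fset_set [set i | x i != 0])) => [|i].
  exact: finmap.fset_uniq.
move=> xi; apply/eqP; apply: contraNT xi => xi.
by rewrite [_ \in _](in_fset_set (dval_finite x)) inE.
Qed.

Lemma fsbigT_seq (T : choiceType) (Z : zmodType) (G : T -> Z) (s : seq T) :
  uniq s -> (forall i, i \notin s -> G i = 0) ->
  \sum_(i \in [set: T]) G i = \sum_(i <- s) G i.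
Proof.
move=> us G0; rewrite [RHS]fsbig_seq // -(fsbig_widen [set` s]) // => i [_ /=].
by move=> /negP; exact: G0.
Qed.

Lemma dlift_seq (Z : lmodType K) (F : forall i j, V i -> V j -> Z)
    (s t : seq int) (x y : dsum) :
  (forall i j, bilinear_op (F i j)) -> uniq s -> uniq t ->
  (forall i, i \notin s -> x i = 0) -> (forall i, i \notin t -> y i = 0) ->
  dlift F x y = \sum_(i <- s) \sum_(j <- t) F i j (x i) (y j).
Proof.
move=> bF us ut xs yt; rewrite /dlift (fsbigT_seq us) => [|i /xs xi].
  apply: eq_bigr => i _; rewrite (fsbigT_seq ut) // => j /yt ->.
  exact: bilin0r.
by rewrite fsbig1 // => j _; rewrite xi (bilin0l (bF _ _)).
Qed.

Lemma dlift_bilinear (Z : lmodType K) (F : forall i j, V i -> V j -> Z) :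
  (forall i j, bilinear_op (F i j)) -> bilinear_op (dlift F).
Proof.
move=> bF; split=> w c x y.
  have [[s us xs] [t ut yt]] := (dsum_support x, dsum_support y).
  have [q uq wq] := dsum_support w; pose st := undup (s ++ t).
  have ust : uniq st by exact: undup_uniq.
  have xst i : i \notin st -> x i = 0.
    by rewrite mem_undup mem_cat negb_or => /andP[/xs].
  have yst i : i \notin st -> y i = 0.
    by rewrite mem_undup mem_cat negb_or => /andP[_ /yt].
  rewrite /= !(dlift_seq bF ust uq) // => [|i inst]; last first.
    by rewrite /= xst // yst // scaler0 addr0.
  rewrite scaler_sumr -big_split; apply: eq_bigr => i _.
  rewrite scaler_sumr -big_split; apply: eq_bigr => j _ /=.
  exact: (bF i j).1.
have [[s us xs] [t ut yt]] := (dsum_support x, dsum_support y).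
have [q uq wq] := dsum_support w; pose st := undup (s ++ t).
have ust : uniq st by exact: undup_uniq.
have xst i : i \notin st -> x i = 0.
  by rewrite mem_undup mem_cat negb_or => /andP[/xs].
have yst i : i \notin st -> y i = 0.
  by rewrite mem_undup mem_cat negb_or => /andP[_ /yt].
rewrite /= !(dlift_seq bF uq ust) // => [|i inst]; last first.
  by rewrite /= xst // yst // scaler0 addr0.
rewrite scaler_sumr -big_split; apply: eq_bigr => i _.
rewrite scaler_sumr -big_split; apply: eq_bigr => j _ /=.
exact: (bF i j).2.
Qed.

Lemma dinj_linear i : linear (@dinj i).
Proof.
move=> c x y; apply: dsumP => j; rewrite /= /eqtype.dfwith /=.
by case: eqP => [ij|_]; [case: _ / ij | rewrite scaler0 addr0].
Qed.

Lemma dsum_span (x : dsum) : exists s : seq int, x = \sum_(i <- s) dinj (x i).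
Proof.
have [s us xs] := dsum_support x; exists s; apply: dsumP => i.
have -> : (\sum_(j <- s) dinj (x j)) i = \sum_(j <- s) dinj (x j) i.
  by apply: (big_morph (fun z : dsum => z i)).
have [si|si] := boolP (i \in s); last first.
  rewrite xs // big1_seq // => j /= sj; rewrite eqtype.dfwith_out //.
  by apply: contraNneq si => <-.
rewrite (bigD1_seq i) //= eqtype.dfwith_in big1 ?addr0 // => j ji.
by rewrite eqtype.dfwith_out.
Qed.

Lemma homogeneous_dinj i (x : dsum) : homogeneous i x -> x = dinj (x i).
Proof.
move=> hx; apply: dsumP => j; have [->|ji] := eqVneq j i.
  by rewrite /= eqtype.dfwith_in.
by rewrite hx //= eqtype.dfwith_out // eq_sym.
Qed.

Lemma homogeneous_dinjP i (x : V i) : homogeneous i (dinj x).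
Proof. by move=> j ji; rewrite /= eqtype.dfwith_out // eq_sym. Qed.

Lemma homogeneousB i (x y : dsum) :
  homogeneous i x -> homogeneous i y -> homogeneous i (x - y).
Proof.
move=> hx hy j ji; have -> : (x - y) j = x j - y j by [].
by rewrite hx // hy // subr0.
Qed.

Lemma homogeneousZ i c (x : dsum) : homogeneous i x -> homogeneous i (c *: x).
Proof.
move=> hx j ji; have -> : (c *: x) j = c *: x j by [].
by rewrite hx // scaler0.
Qed.

Lemma homogeneous_sum i I (s : seq I) (Q : pred I) (x : I -> dsum) :
  (forall k, homogeneous i (x k)) -> homogeneous i (\sum_(k <- s | Q k) x k).
Proof.
move=> hx; elim/big_ind: _ => // y z hy hz j ji.
have -> : (y + z) j = y j + z j by [].
by rewrite hy // hz // addr0.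
Qed.

Lemma dsum_linear_ext (Z : lmodType K) (f g : dsum -> Z) :
  linear f -> linear g -> (forall i (x : V i), f (dinj x) = g (dinj x)) ->
  forall x, f x = g x.
Proof.
move=> lf lg fg x.
pose lF (G : dsum -> Z) (lG : linear G) :
  {linear dsum -> Z} := HB.pack G (GRing.isLinear.Build K _ Z _ G lG).
have [s ->] := dsum_span x.
rewrite -[LHS]/(lF f lf _) -[RHS]/(lF g lg _) !linear_sum.
by apply: eq_bigr => i _; exact: fg.
Qed.

End DirectSum.

Section ZinbielDendriform.
Context {K : fieldType} {P : vectType K}.
Variables rhd lhd : P -> P -> P.

Definition zd_star x y := rhd x y + lhd x y.
Definition zd_ominus x y := rhd x y + lhd y x.

Local Notation "x ▷ y" := (rhd x y) (at level 40, left associativity).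
Local Notation "x ◁ y" := (lhd x y) (at level 40, left associativity).
Local Notation "x ∗ y" := (zd_star x y) (at level 40, left associativity).
Local Notation "x ⊖ y" := (zd_ominus x y) (at level 40, left associativity).

Record zinbiel_dendriform : Prop := ZinbielDendriform {
  zd_rhd_bilinear : bilinear_op rhd;
  zd_lhd_bilinear : bilinear_op lhd;
  zd_rhd_rhd : forall x y z, x ▷ (y ▷ z) = (x ∗ y + y ∗ x) ▷ z;
  zd_rhd_lhd : forall x y z, x ▷ (z ◁ y) = z ◁ (x ∗ y);
  zd_lhd_star : forall x y z, z ◁ (x ∗ y) = (x ▷ z) ◁ y + (z ◁ x) ◁ y }.

Definition zd_ybe (r : tens P P) : Prop :=
  tlift (fun u v => tlift (fun u' v' =>
       tpure3 u (v ⊖ u') v' - tpure3 u u' (v ∗ v') + tpure3 (u ◁ u') v' v)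
     r) r = 0.

Lemma zd_star_bilinear : zinbiel_dendriform -> bilinear_op zd_star.
Proof.
move=> [bR bL _ _ _]; split=> w.
  exact: linear_comp_add (bR.1 w) (bL.1 w).
exact: linear_comp_add (bR.2 w) (bL.2 w).
Qed.

Lemma zd_ominus_bilinear : zinbiel_dendriform -> bilinear_op zd_ominus.
Proof.
move=> [bR bL _ _ _]; split=> w.
  exact: linear_comp_add (bR.1 w) (bL.2 w).
exact: linear_comp_add (bR.2 w) (bL.1 w).
Qed.

Lemma zd_ybeE n (u v : 'I_n -> P) : zinbiel_dendriform ->
  zd_ybe (\sum_i tpure (u i) (v i)) <->
  \sum_i \sum_j (tpure3 (u i) (v i ⊖ u j) (v j) - tpure3 (u i) (u j) (v i ∗ v j)
                  + tpure3 (u i ◁ u j) (v j) (v i)) = 0.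
Proof.
move=> zdP; have [bS bO] := (zd_star_bilinear zdP, zd_ominus_bilinear zdP).
have bL := zd_lhd_bilinear zdP; have bT A B := @tpure_bilinear K A B.
rewrite /zd_ybe tlift_sum; set S1 := \sum_(i < n) tlift _ _.
set S2 := \sum_(i < n) _; suff -> : S1 = S2 by [].
have l3 (T A B C : vectType K) f g h := fun lf : linear f =>
  linear_comp (Z' := tens A (tens B C)) ((bT A (tens B C)).1 (tpure g h)) (f:=f) (T:=T) lf.
have m3 (T A B C : vectType K) f g h := fun lf : linear f =>
  linear_comp ((bT A (tens B C)).2 g) (linear_comp ((bT B C).1 h) (f:=f) (T:=T) lf).
have r3 (T A B C : vectType K) f g h := fun lf : linear f =>
  linear_comp ((bT A (tens B C)).2 g) (linear_comp ((bT B C).2 h) (f:=f) (T:=T) lf).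
have lid (T : vectType K) : linear (fun t : T => t) by [].
apply: eq_bigr => i _; rewrite tlift_tpure.
  rewrite tlift_sum; apply: eq_bigr => j _; rewrite tlift_tpure //.
  split=> w; (apply: linear_comp_add; first apply: linear_comp_add).
  - exact: m3 (bO.2 _).
  - exact: linear_comp_opp (m3 _ _ _ _ _ _ _ (lid _)).
  - exact: l3 (bL.2 _).
  - exact: r3 (lid _).
  - exact: linear_comp_opp (r3 _ _ _ _ _ _ _ (bS.2 _)).
  - exact: m3 (lid _).
split=> w; apply: tlift_fun_linear => u' v';
  (apply: linear_comp_add; first apply: linear_comp_add).
- exact: l3 (lid _).
- exact: linear_comp_opp (l3 _ _ _ _ _ _ _ (lid _)).
- exact: l3 (bL.1 _).
- exact: m3 (bO.1 _).
- exact: linear_comp_opp (r3 _ _ _ _ _ _ _ (bS.1 _)).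
- exact: r3 (lid _).
Qed.

Definition zd_invariant (s : tens P P) : Prop :=
  forall m : P,
    tlift (fun u v => tpure u (m ⊖ v) - tpure (m ∗ u) v) s = 0 /\
    tlift (fun u v => tpure (m ▷ u) v - tpure u (m ∗ v + v ∗ m)) s = 0.

Definition skew_symmetric (r : tens P P) : Prop := tflip r = - r.

End ZinbielDendriform.

Section Leibniz.
Context {K : fieldType} {Q_ : int -> vectType K}.
Local Notation Q := (dsum Q_).

Record quadratic_graded_leibniz (circ : Q -> Q -> Q) (varpi : Q -> Q -> K) :
    Prop := QuadraticGradedLeibniz {
  qgl_bilinear : bilinear_op circ;
  qgl_graded : forall i j x y,
    homogeneous i x -> homogeneous j y -> homogeneous (i + j) (circ x y);
  qgl_leibniz : forall x y z,
    circ x (circ y z) = circ (circ x y) z + circ y (circ x z);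
  qgl_form_bilinear : bilinear_form varpi;
  qgl_form_skew : forall x y, varpi x y = - varpi y x;
  qgl_form_nondegenerate : forall x, (forall y, varpi x y = 0) -> x = 0;
  qgl_form_invariant : forall x y z,
    varpi (circ x y) z = varpi x (circ y z + circ z y);
  qgl_form_graded : exists m : int, forall i j x y,
    homogeneous i x -> homogeneous j y -> i + j + m != 0 -> varpi x y = 0 }.

Record homogeneous_basis (Omega : choiceType) (e : Omega -> Q) : Prop :=
    HomogeneousBasis {
  hb_homogeneous : forall j, exists i, homogeneous i (e j);
  hb_free : forall (s : seq Omega) (c : Omega -> K),
    uniq s -> \sum_(j <- s) c j *: e j = 0 -> forall j, j \in s -> c j = 0;
  hb_span : forall x : Q, exists (s : seq Omega) (c : Omega -> K),
    x = \sum_(j <- s) c j *: e j }.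

Definition dual_families (varpi : Q -> Q -> K) (Omega : choiceType)
    (e f : Omega -> Q) : Prop :=
  forall i j, varpi (e i) (f j) = (i == j)%:R.

End Leibniz.

Section Completed.
Context {K : fieldType} {L_ : int -> vectType K}.
Local Notation L := (dsum L_).

(* The completed tensor product of [L] with itself: arbitrary families of
   bihomogeneous components. *)
Definition ctens2 := forall i j : int, tens (L_ i) (L_ j).

Definition cpure (a b : L) : ctens2 := fun i j => tpure (a i) (b j).
Definition csub (s t : ctens2) : ctens2 := fun i j => s i j - t i j.
Definition cflip (s : ctens2) : ctens2 := fun i j => tflip (s j i).

Definition csymmetric (s : ctens2) : Prop := forall i j, cflip s i j = s i j.

Variable dot : L -> L -> L.

(* [cdot a b k] is the degree [k] component of [a · b], for [a] of degree
   [p] and [b] of degree [q]. *)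
Definition cdot p q (a : L_ p) (b : L_ q) (k : int) : L_ k :=
  dot (dinj a) (dinj b) k.

(* Degree [(i, j, k)] contributions of two homogeneous components of [r] to
   [r12 · r13], [r12 · r23] and [[r13, r23]]. *)
Definition s_term1213 (r : ctens2) i j k (pq : int * int) :
    tens (L_ i) (tens (L_ j) (L_ k)) :=
  tlift (fun a b => tlift (fun a' b' =>
    tpure3 (cdot a a' i) b b') (r pq.2 k)) (r pq.1 j).

Definition s_term1223 (r : ctens2) i j k (pq : int * int) :
    tens (L_ i) (tens (L_ j) (L_ k)) :=
  tlift (fun a b => tlift (fun a' b' =>
    tpure3 a (cdot b a' j) b') (r pq.2 k)) (r i pq.1).

Definition s_term1323 (r : ctens2) i j k (pq : int * int) :
    tens (L_ i) (tens (L_ j) (L_ k)) :=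
  tlift (fun a b => tlift (fun a' b' =>
    tpure3 a a' (cdot b b' k - cdot b' b k)) (r j pq.2)) (r i pq.1).

Definition summable (I : choiceType) (Z : zmodType) (F : I -> Z) : Prop :=
  finite_set [set i | F i != 0].

(* Each term of the equation is a formal sum; being an element of the completed
   tensor product means that it is finite in every degree [(i, j, k)]. *)
Definition s_solution (r : ctens2) : Prop :=
  forall i j k,
    [/\ summable (s_term1213 r i j k), summable (s_term1223 r i j k),
        summable (s_term1323 r i j k) &
        \sum_(pq \in [set: int * int]) s_term1213 r i j k pq
        - \sum_(pq \in [set: int * int]) s_term1223 r i j k pq
        - \sum_(pq \in [set: int * int]) s_term1323 r i j k pq = 0].

(* The sums over [p] are finite when [dot] is graded, as [x] has finitely many
   homogeneous components. *)
Definition s_invariant (s : ctens2) : Prop :=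
  forall (x : L) i j,
    \sum_(p \in [set: int])
       tlift (fun a b => tpure (dot x (dinj a) i) b) (s p j)
    + \sum_(p \in [set: int])
       tlift (fun a b => tpure a (dot x (dinj b) j - dot (dinj b) x j)) (s i p)
    = 0.

End Completed.

Record graded_pre_lie (K : fieldType) (L_ : int -> vectType K)
    (dot : dsum L_ -> dsum L_ -> dsum L_) : Prop := GradedPreLie {
  gpl_bilinear : bilinear_op dot;
  gpl_graded : forall i j x y,
    homogeneous i x -> homogeneous j y -> homogeneous (i + j) (dot x y);
  gpl_pre_lie : forall x y z,
    dot (dot x y) z - dot x (dot y z) = dot (dot y x) z - dot y (dot x z) }.

Section PreLie.
Context {K : fieldType} {P : vectType K} {Q_ : int -> vectType K}.
Variables (rhd lhd : P -> P -> P) (circ : dsum Q_ -> dsum Q_ -> dsum Q_).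

Definition PQ (i : int) : vectType K := tens P (Q_ i).

Lemma gpure_subproof (a : P) (x : dsum Q_) :
  finite_set [set i | (tpure a (x i) : PQ i) != 0].
Proof.
apply: (sub_finite_set _ (dval_finite x)) => i /=.
apply: contra_neq => ->; apply/matrixP=> k l.
by rewrite tpureE linear0 !mxE mulr0.
Qed.

(* [a ⊗ x], as an element of the direct sum of the [P ⊗ Q_i]. *)
Definition gpure (a : P) (x : dsum Q_) : dsum PQ :=
  DSum (gpure_subproof a x).

Lemma gpure_bilinear : bilinear_op gpure.
Proof.
by split=> w c x y; apply: dsumP => i;
  [apply: (tpure_bilinear _ _).1 | apply: (tpure_bilinear _ _).2].
Qed.

Lemma gpure_dinj a i (x : Q_ i) : gpure a (dinj x) = @dinj _ PQ i (tpure a x).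
Proof.
apply: dsumP => j /=; rewrite /eqtype.dfwith /=; case: eqP => [ij|_].
  by case: _ / ij.
by rewrite (bilin0r (tpure_bilinear _ _)).
Qed.

(* The bilinear product given on pure tensors by [pq_dot_gpure]. *)
Definition pq_dot : dsum PQ -> dsum PQ -> dsum PQ :=
  dlift (fun i j (A : PQ i) (B : PQ j) =>
    tlift (fun a x => tlift (fun b y =>
      gpure (rhd a b) (circ (dinj x) (dinj y))
      - gpure (lhd b a) (circ (dinj y) (dinj x))) B) A).

Lemma pq_dot_bilinear : bilinear_op pq_dot.
Proof.
apply: dlift_bilinear => i j; split=> [B|A]; first exact: tlift_linear.
by apply: tlift_fun_linear => a x; exact: tlift_linear.
Qed.

Lemma pq_dot_gpure (a b : P) (x y : dsum Q_) :
  bilinear_op rhd -> bilinear_op lhd -> bilinear_op circ ->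
  pq_dot (gpure a x) (gpure b y)
  = gpure (rhd a b) (circ x y) - gpure (lhd b a) (circ y x).
Proof.
move=> bR bL bC; have bG := gpure_bilinear; have bD := pq_dot_bilinear.
have dotE i j (x' : Q_ i) (y' : Q_ j) :
    pq_dot (gpure a (dinj x')) (gpure b (dinj y'))
    = gpure (rhd a b) (circ (dinj x') (dinj y'))
      - gpure (lhd b a) (circ (dinj y') (dinj x')).
  rewrite !gpure_dinj /pq_dot dlift_dinj => [|k l]; last first.
    split=> [B|A]; first exact: tlift_linear.
    by apply: tlift_fun_linear => ? ?; exact: tlift_linear.
  rewrite tlift_tpure; last first.
    split=> w; apply: tlift_fun_linear => u v; apply: linear_comp_add.
    - exact: linear_comp (bG.1 _) (bR.1 _).
    - exact: linear_comp_opp (linear_comp (bG.1 _) (bL.2 _)).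
    - exact: linear_comp (bG.2 _) (linear_comp (bC.1 _) (@dinj_linear _ _ _)).
    - apply: linear_comp_opp.
      exact: linear_comp (bG.2 _) (linear_comp (bC.2 _) (@dinj_linear _ _ _)).
  rewrite tlift_tpure //; split=> w; apply: linear_comp_add.
  - exact: linear_comp (bG.1 _) (bR.2 _).
  - exact: linear_comp_opp (linear_comp (bG.1 _) (bL.1 _)).
  - exact: linear_comp (bG.2 _) (linear_comp (bC.2 _) (@dinj_linear _ _ _)).
  - apply: linear_comp_opp.
    exact: linear_comp (bG.2 _) (linear_comp (bC.1 _) (@dinj_linear _ _ _)).
have [[s {1 2 3}->] [t {1 2 3}->]] := (dsum_span x, dsum_span y).
rewrite !(bilin_sumr bG) (bilin_suml bD) (bilin_suml bC) (bilin_sumr bC).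
rewrite !(bilin_sumr bG) [X in _ - X](_ : _ = \sum_(i <- s) \sum_(j <- t)
    gpure (lhd b a) (circ (dinj (y j)) (dinj (x i)))); last first.
  by apply: eq_bigr => i _; rewrite (bilin_suml bC) (bilin_sumr bG).
rewrite -sumrB; apply: eq_bigr => i _; rewrite (bilin_sumr bD) (bilin_sumr bC).
by rewrite (bilin_sumr bG) -sumrB; apply: eq_bigr => j _; exact: dotE.
Qed.

Lemma pq_linear_ext (Z : lmodType K) (f g : dsum PQ -> Z) :
  linear f -> linear g -> (forall a x, f (gpure a x) = g (gpure a x)) ->
  forall X, f X = g X.
Proof.
move=> lf lg fg X.
pose lF (G : dsum PQ -> Z) (lG : linear G) :
  {linear dsum PQ -> Z} := HB.pack G (GRing.isLinear.Build K _ Z _ G lG).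
have ext (G : dsum PQ -> Z) (lG : linear G) i (A : PQ i) : G (dinj A) =
    \sum_a \sum_b A a b *: G (gpure (r2v (delta_mx 0 a))
                                    (dinj (r2v (delta_mx 0 b)))).
  pose dl : {linear PQ i -> dsum PQ} :=
    HB.pack (@dinj _ PQ i) (GRing.isLinear.Build K _ _ _ _ (@dinj_linear _ PQ i)).
  rewrite -[LHS]/(lF G lG (dl A)) [in LHS](tensE A) !linear_sum.
  apply: eq_bigr => a _; rewrite !linear_sum; apply: eq_bigr => b _.
  by rewrite !linearZ /= gpure_dinj.
have [s ->] := dsum_span X.
rewrite -[LHS]/(lF f lf _) -[RHS]/(lF g lg _) !linear_sum.
apply: eq_bigr => i _; rewrite /= !ext //.
by apply: eq_bigr => a _; apply: eq_bigr => b _; rewrite fg.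
Qed.

Lemma pq_dot_pre_lie (varpi : dsum Q_ -> dsum Q_ -> K) :
  zinbiel_dendriform rhd lhd -> quadratic_graded_leibniz circ varpi ->
  graded_pre_lie pq_dot.
Proof.
move=> zdP [bC gC leib _ _ _ _ _]; have bD := pq_dot_bilinear.
have bG := gpure_bilinear; case: (zdP) => bR bL rr rl ls.
split=> // [i j X Y hX hY k kij|].
  rewrite (homogeneous_dinj hX) (homogeneous_dinj hY) /pq_dot dlift_dinj.
    rewrite /tlift; move: k kij; do 4 (apply: homogeneous_sum => ?;
      try apply: homogeneousZ).
    have hG a x : homogeneous (i + j) x -> homogeneous (i + j) (gpure a x).
      by move=> hx k kij /=; rewrite hx // (bilin0r (tpure_bilinear _ _)).
    apply: homogeneousB; apply: hG; last rewrite addrC; apply: gC;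
      exact: homogeneous_dinjP.
  move=> k1 l1; split=> [B|A]; first exact: tlift_linear.
  by apply: tlift_fun_linear => ? ?; exact: tlift_linear.
pose ass X Y Z := pq_dot (pq_dot X Y) Z - pq_dot X (pq_dot Y Z).
have lass1 Y Z : linear (fun X => ass X Y Z).
  apply: linear_comp_add; first exact: linear_comp (bD.1 _) (bD.1 _).
  exact: linear_comp_opp (bD.1 _).
have lass2 X Z : linear (fun Y => ass X Y Z).
  apply: linear_comp_add; first exact: linear_comp (bD.1 _) (bD.2 _).
  exact: linear_comp_opp (linear_comp (bD.2 _) (bD.1 _)).
have lass3 X Y : linear (fun Z => ass X Y Z).
  apply: linear_comp_add; first exact: bD.2.
  exact: linear_comp_opp (linear_comp (bD.2 _) (bD.2 _)).
move=> X Y Z; rewrite -/(ass X Y Z) -/(ass Y X Z).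
apply: (pq_linear_ext (lass1 Y Z) (lass2 Y Z)) => a x {X}.
apply: (pq_linear_ext (lass2 _ Z) (lass1 _ Z)) => b y {Y}.
apply: (pq_linear_ext (lass3 _ _) (lass3 _ _)) => c z {Z}.
rewrite /ass !pq_dot_gpure // !(bilinDl bD, bilinNl bD, bilinDr bD, bilinNr bD).
rewrite !pq_dot_gpure //; apply: dsumP => i; apply/matrixP => k l.
have add0 (A B : dsum PQ) : (A + B) i = A i + B i by [].
have opp0 (A : dsum PQ) : (- A) i = - A i by [].
have addE (A B : PQ i) : (A + B) k l = A k l + B k l by rewrite mxE.
have oppE (A : PQ i) : (- A) k l = - A k l by rewrite mxE.
have gE a' x' : gpure a' x' i k l = v2r a' 0 k * v2r (x' i) 0 l by exact: tpureE.
rewrite !(add0, opp0) !(addE, oppE) !gE.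
have mE : forall u v w, circ (circ u v) w = circ u (circ v w) - circ v (circ u w).
  by move=> u v w; rewrite leib addrK.
pose q u v w := v2r (circ u (circ v w) i) 0 l.
have vE u v w : v2r (circ (circ u v) w i) 0 l = q u v w - q v u w.
  rewrite mE; have -> : forall A B : dsum Q_, (A - B) i = A i - B i by [].
  by rewrite linearB !mxE.
rewrite !vE -![v2r (circ _ (circ _ _) i) 0 l]/(q _ _ _).
move: (q x y z) (q y x z) (q x z y) (q y z x) (q z x y) (q z y x).
move=> q0 q1 q2 q3 q4 q5; set p := fun u : P => v2r u 0 k.
have pD u v : p (u + v) = p u + p v by rewrite /p linearD mxE.
have rrE u v w : p (rhd u (rhd v w)) = p (rhd (rhd u v) w)
    + p (rhd (lhd u v) w) + (p (rhd (rhd v u) w) + p (rhd (lhd v u) w)).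
  by rewrite rr /zd_star !(bilinDl bR) !pD.
have rlE u v w : p (rhd u (lhd w v)) = p (lhd w (rhd u v)) + p (lhd w (lhd u v)).
  by rewrite rl /zd_star !(bilinDr bL) !pD.
have llE u v w : p (lhd (lhd w u) v) =
    p (lhd w (rhd u v)) + p (lhd w (lhd u v)) - p (lhd (rhd u w) v).
  by rewrite -!pD -(bilinDr bL) -/(zd_star rhd lhd u v) ls pD addrC addKr.
by rewrite -![v2r _ 0 k]/(p _) !rrE !rlE !llE; ring.
Qed.


(* In each bidegree only finitely many [j] contribute, since the homogeneous
   components of the graded space are finite-dimensional. *)
Definition r_hat (Omega : choiceType) (e f : Omega -> dsum Q_)
    n (u v : 'I_n -> P) : ctens2 (L_ := PQ) :=
  fun p q => \sum_(i < n) \sum_(j \in [set: Omega])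
    cpure (gpure (u i) (e j)) (gpure (v i) (f j)) p q.

End PreLie.

Section Laurent.
Variable K : fieldType.

Definition W : vectType K := 'rV[K]_4.

(* [eps 1], .., [eps 4] is the basis of [W]; indices start from 1. *)
Definition eps (k : nat) : W := \row_(i < 4) (i.+1 == k :> nat)%:R.

Definition w_table (i j : nat) : W :=
  match i, j with
  | 2%N, 1%N => eps 1
  | 2%N, 2%N => eps 1
  | 2%N, 3%N => - eps 3 - eps 4
  | 3%N, 1%N => eps 4
  | 3%N, 2%N => eps 3 + 2 *: eps 4
  | _, _ => 0
  end.

Definition nu_table (i j : nat) : K :=
  match i, j with
  | 1%N, 3%N => 1
  | 2%N, 4%N => 1
  | 3%N, 1%N => -1
  | 4%N, 2%N => -1
  | _, _ => 0
  end.

Definition w_circ (x y : W) : W :=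
  \sum_(i < 4) \sum_(j < 4) (x 0 i * y 0 j) *: w_table i.+1 j.+1.

Definition w_nu (x y : W) : K :=
  \sum_(i < 4) \sum_(j < 4) x 0 i * y 0 j * nu_table i.+1 j.+1.

(* W ⊗ K[t, t^-1] is the direct sum of copies [W t^m] of [W]; [wt x m] is
   [x t^m]. *)
Definition W_ (m : int) : vectType K := W.

Definition wt (x : W) (m : int) : dsum W_ := @dinj K W_ m x.

Definition wt_circ : dsum W_ -> dsum W_ -> dsum W_ :=
  dlift (fun m n (x : W_ m) (y : W_ n) => wt (w_circ x y) (m + n)).

Definition wt_varpi : dsum W_ -> dsum W_ -> K :=
  dlift (Z := K^o)
    (fun m n (x : W_ m) (y : W_ n) => w_nu x y * (m + n == 0)%:R).

Lemma w_circ_bilinear : bilinear_op w_circ.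
Proof.
split=> w c x y; rewrite /= /w_circ scaler_sumr -big_split; apply: eq_bigr => i _;
  rewrite scaler_sumr -big_split; apply: eq_bigr => j _ /=;
  rewrite !mxE scalerA -scalerDl; congr (_ *: _).
  by rewrite mulrDl mulrA.
by rewrite mulrDr mulrCA.
Qed.

Lemma w_nu_bilinear : bilinear_form w_nu.
Proof.
split=> w c x y; rewrite /= /w_nu /= mulr_sumr -big_split; apply: eq_bigr => i _;
  rewrite mulr_sumr -big_split; apply: eq_bigr => j _ /=;
  rewrite !mxE mulrA -mulrDl; congr (_ * _).
  by rewrite mulrDl mulrA.
by rewrite mulrDr mulrCA.
Qed.

Lemma w_circ_eps i j : (0 < i <= 4)%N -> (0 < j <= 4)%N ->
  w_circ (eps i) (eps j) = w_table i j.
Proof.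
case: i => [|i] // /andP[_ i4]; case: j => [|j] // /andP[_ j4].
rewrite /w_circ (bigD1 (Ordinal i4)) //= [X in _ + X]big1 => [|k ki]; last first.
  by rewrite big1 // => l _; rewrite mxE eqSS [_ == i](negPf ki) mul0r scale0r.
rewrite addr0 (bigD1 (Ordinal j4)) //= [X in _ + X]big1 => [|l lj]; last first.
  by rewrite !mxE !eqSS [_ == j](negPf lj) mulr0 scale0r.
by rewrite !mxE !eqxx mulr1 scale1r addr0.
Qed.

Lemma w_nu_eps i j : (0 < i <= 4)%N -> (0 < j <= 4)%N ->
  w_nu (eps i) (eps j) = nu_table i j.
Proof.
case: i => [|i] // /andP[_ i4]; case: j => [|j] // /andP[_ j4].
rewrite /w_nu (bigD1 (Ordinal i4)) //= [X in _ + X]big1 => [|k ki]; last first.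
  by rewrite big1 // => l _; rewrite mxE eqSS [_ == i](negPf ki) !mul0r.
rewrite addr0 (bigD1 (Ordinal j4)) //= [X in _ + X]big1 => [|l lj]; last first.
  by rewrite !mxE !eqSS [_ == j](negPf lj) mulr0 mul0r.
by rewrite !mxE !eqxx !mul1r addr0.
Qed.

Lemma wt_circ_wt x y m n :
  wt_circ (wt x m) (wt y n) = wt (w_circ x y) (m + n).
Proof.
apply: dlift_dinj => i j; split=> w.
  exact: linear_comp (@dinj_linear _ W_ _) (w_circ_bilinear.1 w).
exact: linear_comp (@dinj_linear _ W_ _) (w_circ_bilinear.2 w).
Qed.

Lemma wt_varpi_wt x y m n :
  wt_varpi (wt x m) (wt y n) = w_nu x y * (m + n == 0)%:R.
Proof.
apply: (dlift_dinj (Z := K^o)) => i j; split=> w c x' y'.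
  by rewrite /= w_nu_bilinear.1 /= mulrDl -mulrA.
by rewrite /= w_nu_bilinear.2 /= mulrDl -mulrA.
Qed.

Lemma w_circE (x y : W) k : w_circ x y 0 k =
  let x_ i := x 0 (inord i) in let y_ i := y 0 (inord i) in
  match val k with
  | 0%N => x_ 1%N * y_ 0%N + x_ 1%N * y_ 1%N
  | 2%N => x_ 2%N * y_ 1%N - x_ 1%N * y_ 2%N
  | 3%N => x_ 2%N * y_ 0%N + 2 * (x_ 2%N * y_ 1%N) - x_ 1%N * y_ 2%N
  | _ => 0
  end.
Proof.
have e0 : ord0 = inord 0 :> 'I_4 by apply/val_inj; rewrite /= inordK.
have e1 : lift ord0 ord0 = inord 1 :> 'I_4 by apply/val_inj; rewrite /= inordK.
have e2 : lift ord0 (lift ord0 ord0) = inord 2 :> 'I_4.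
  by apply/val_inj; rewrite /= inordK.
have e3 : lift ord0 (lift ord0 (lift ord0 ord0)) = inord 3 :> 'I_4.
  by apply/val_inj; rewrite /= inordK.
rewrite /w_circ !big_ord_recl !big_ord0 /= !mxE /= e3 e2 e1 e0.
by case: k => [[|[|[|[|k]]]] k4] //=; ring.
Qed.

Lemma w_nuE (x y : W) : w_nu x y =
  let x_ i := x 0 (inord i) in let y_ i := y 0 (inord i) in
  x_ 0%N * y_ 2%N - x_ 2%N * y_ 0%N + x_ 1%N * y_ 3%N - x_ 3%N * y_ 1%N.
Proof.
have e0 : ord0 = inord 0 :> 'I_4 by apply/val_inj; rewrite /= inordK.
have e1 : lift ord0 ord0 = inord 1 :> 'I_4 by apply/val_inj; rewrite /= inordK.
have e2 : lift ord0 (lift ord0 ord0) = inord 2 :> 'I_4.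
  by apply/val_inj; rewrite /= inordK.
have e3 : lift ord0 (lift ord0 (lift ord0 ord0)) = inord 3 :> 'I_4.
  by apply/val_inj; rewrite /= inordK.
by rewrite /w_nu !big_ord_recl !big_ord0 /= e3 e2 e1 e0; ring.
Qed.

Lemma w_circ_leibniz x y z :
  w_circ x (w_circ y z) = w_circ (w_circ x y) z + w_circ y (w_circ x z).
Proof.
apply/matrixP=> o k; rewrite ord1 mxE !w_circE /= !w_circE /= !inordK //=.
by case: k => [[|[|[|[|k]]]] k4] //=; ring.
Qed.

Lemma w_nu_invariant x y z :
  w_nu (w_circ x y) z = w_nu x (w_circ y z + w_circ z y).
Proof. by rewrite !w_nuE /= !mxE !w_circE /= !inordK //=; ring. Qed.

Lemma wt_quadratic : quadratic_graded_leibniz wt_circ wt_varpi.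
Proof.
have bC : bilinear_op wt_circ.
  apply: dlift_bilinear => i j; split=> w.
    exact: linear_comp (@dinj_linear _ W_ _) (w_circ_bilinear.1 w).
  exact: linear_comp (@dinj_linear _ W_ _) (w_circ_bilinear.2 w).
have bN : bilinear_op (wt_varpi : _ -> _ -> K^o).
  apply: (dlift_bilinear (Z := K^o)) => i j; split=> w c x' y'.
    by rewrite /= w_nu_bilinear.1 /= mulrDl -mulrA.
  by rewrite /= w_nu_bilinear.2 /= mulrDl -mulrA.
split=> //.
- move=> i j x y hx hy; rewrite (homogeneous_dinj hx) (homogeneous_dinj hy).
  by rewrite -!/(wt _ _) wt_circ_wt; exact: homogeneous_dinjP.
- move=> x y z.
  apply: (@dsum_linear_ext _ _ _ (fun x => wt_circ x (wt_circ y z))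
    (fun x => wt_circ (wt_circ x y) z + wt_circ y (wt_circ x z))).
  + exact: bC.1.
  + apply: linear_comp_add; first exact: linear_comp (bC.1 _) (bC.1 _).
    exact: linear_comp (bC.2 _) (bC.1 _).
  move=> i {}x; apply: (@dsum_linear_ext _ _ _
    (fun y => wt_circ (dinj x) (wt_circ y z)) (fun y =>
      wt_circ (wt_circ (dinj x) y) z + wt_circ y (wt_circ (dinj x) z))).
  + exact: linear_comp (bC.2 _) (bC.1 _).
  + by apply: linear_comp_add; first exact: linear_comp (bC.1 _) (bC.2 _);
      exact: bC.1.
  move=> j {}y; apply: (@dsum_linear_ext _ _ _
    (fun z => wt_circ (dinj x) (wt_circ (dinj y) z)) (fun z =>
      wt_circ (wt_circ (dinj x) (dinj y)) z
      + wt_circ (dinj y) (wt_circ (dinj x) z))).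
  + exact: linear_comp (bC.2 _) (bC.2 _).
  + by apply: linear_comp_add (bC.2 _) _; exact: linear_comp (bC.2 _) (bC.2 _).
  move=> k {}z; rewrite -!/(wt _ _) !wt_circ_wt w_circ_leibniz.
  rewrite addrA [j + (i + k)]addrCA [i + (j + k)]addrA.
  have := @dinj_linear _ W_ (i + j + k) 1 (w_circ (w_circ x y) z)
    (w_circ y (w_circ x z)).
  by rewrite !scale1r.
- move=> x y; apply: (@dsum_linear_ext _ _ K^o (fun x => wt_varpi x y)
    (fun x => - wt_varpi y x)).
  + exact: bN.1.
  + exact: linear_comp_opp (bN.2 _).
  move=> i {}x; apply: (@dsum_linear_ext _ _ K^o (fun y => wt_varpi (dinj x) y)
    (fun y => - wt_varpi y (dinj x))).
  + exact: bN.2.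
  + exact: linear_comp_opp (bN.1 _).
  move=> j {}y; rewrite -!/(wt _ _) !wt_varpi_wt addrC -mulNr; congr (_ * _).
  by rewrite !w_nuE /=; ring.
- move=> x x0; apply: dsumP => i.
  have nu0 w : w_nu (x i) w = 0.
    rewrite -(x0 (wt w (- i))); apply/esym.
    apply: (@dsum_linear_ext _ _ K^o (fun x => wt_varpi x (wt w (- i)))
      (fun x => w_nu (x i) w)).
    + exact: bN.1.
    + by move=> c u v /=; rewrite w_nu_bilinear.1.
    move=> j {x0}x; rewrite -!/(wt _ _) wt_varpi_wt /= subr_eq0.
    have [ji|ji] := eqVneq j i.
      by rewrite mulr1 -{1}ji /wt; case: _ / ji; rewrite /= eqtype.dfwith_in.
    by rewrite mulr0 /wt /= eqtype.dfwith_out // w_nuE /= !mxE; ring.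
  have nuE w : w_nu (x i) w = x i 0 (inord 0) * w 0 (inord 2)
      - x i 0 (inord 2) * w 0 (inord 0) + x i 0 (inord 1) * w 0 (inord 3)
      - x i 0 (inord 3) * w 0 (inord 1) by exact: w_nuE.
  have := (nu0 (eps 3), nu0 (eps 4), nu0 (eps 1), nu0 (eps 2)).
  rewrite !nuE !mxE !inordK //= !(mulr0, mulr1, subr0, addr0, add0r, sub0r).
  move=> [[[c0 c1] /eqP] c2 /eqP]; rewrite !oppr_eq0 => /eqP c3.
  move: c2; rewrite oppr_eq0 => /eqP c2.
  apply/matrixP=> o k; rewrite ord1 mxE -[k]inord_val.
  by case: k => [[|[|[|[|k]]]] k4] //=.
- move=> x y z.
  apply: (@dsum_linear_ext _ _ K^o (fun x => wt_varpi (wt_circ x y) z)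
    (fun x => wt_varpi x (wt_circ y z + wt_circ z y))).
  + exact: linear_comp (bN.1 _) (bC.1 _).
  + exact: bN.1.
  move=> i {}x; apply: (@dsum_linear_ext _ _ K^o
    (fun y => wt_varpi (wt_circ (dinj x) y) z)
    (fun y => wt_varpi (dinj x) (wt_circ y z + wt_circ z y))).
  + exact: linear_comp (bN.1 _) (bC.2 _).
  + apply: linear_comp (bN.2 _) _; apply: linear_comp_add (bC.1 _) (bC.2 _).
  move=> j {}y; apply: (@dsum_linear_ext _ _ K^o
    (fun z => wt_varpi (wt_circ (dinj x) (dinj y)) z)
    (fun z => wt_varpi (dinj x) (wt_circ (dinj y) z + wt_circ z (dinj y)))).
  + exact: bN.2.
  + apply: linear_comp (bN.2 _) _; apply: linear_comp_add (bC.2 _) (bC.1 _).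
  move=> k {}z; rewrite -!/(wt _ _) !wt_circ_wt wt_varpi_wt w_nu_invariant.
  rewrite [k + j]addrC.
  have := @dinj_linear _ W_ (j + k) 1 (w_circ y z) (w_circ z y).
  by rewrite !scale1r -!/(wt _ _) => <-; rewrite wt_varpi_wt addrA.
- exists 0 => i j x y hx hy; rewrite addr0 => ij.
  rewrite (homogeneous_dinj hx) (homogeneous_dinj hy) -!/(wt _ _) wt_varpi_wt.
  by rewrite (negPf ij) mulr0.
Qed.

Definition r_hat_W (P : vectType K) n (u v : 'I_n -> P) :
    ctens2 (L_ := PQ (P := P) (Q_ := W_)) :=
  fun p q => \sum_(m \in [set: int]) \sum_(i < n)
    (  cpure (gpure (u i) (wt (eps 1) m)) (gpure (v i) (wt (eps 3) (- m))) p q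
     + cpure (gpure (u i) (wt (eps 2) m)) (gpure (v i) (wt (eps 4) (- m))) p q
     - cpure (gpure (u i) (wt (eps 3) m)) (gpure (v i) (wt (eps 1) (- m))) p q
     - cpure (gpure (u i) (wt (eps 4) m)) (gpure (v i) (wt (eps 2) (- m))) p q).

End Laurent.

(* Main.v *)
(* Contracting the factors of [Q] with the form, against homogeneous [x, y, z],
   is injective on the completed tensor powers of [P ⊗ Q], and turns the canonical
   element [\sum_j e_j ⊗ f_j] into substitution.  By invariance of the form,
   [ϖ(x ∘ z, y) = ϖ(x ∘ y, z)] and the values of [ϖ] on [z ∘ x, y], [x ∘ y, z] and
   [y ∘ x, z] add up to zero, so the contracted S-equation is
   [ϖ(x ∘ y, z) A + ϖ(y ∘ x, z) B = 0] with [A, B] in [P ⊗ P ⊗ P].  Here [A] is the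
   left-hand side of the ZD-YBE, and [B + (τ ⊗ I) A] vanishes when [r + τ(r)] is
   invariant.  In the same way [r̂ - τ(r̂)] is built from [r + τ(r)], and its
   invariance contracts to two conditions with coefficients [ϖ(w ∘ x, y)] and
   [ϖ(x ∘ w, y)], which together are equivalent to the invariance of [r + τ(r)].
   For the Laurent algebra the pair [(ϖ(x ∘ y, z), ϖ(y ∘ x, z))] takes the values
   [(1, 0)] and [(0, 1)], which gives the converse. *)
Require Import Defs.
From mathcomp Require Import all_boot all_order all_algebra.
From mathcomp Require Import all_classical.
From mathcomp Require Import ring.

Set Implicit Arguments.
Unset Strict Implicit.
Unset Printing Implicit Defensive.

Import GRing.Theory.
Local Open Scope ring_scope.
Import VectorInternalTheory.

(** * Linear maps and tensor products *)

Section LinearMaps.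
Context {K : fieldType} {T Z : lmodType K} (f : T -> Z).
Hypothesis lf : linear f.

Lemma linfD x y : f (x + y) = f x + f y.
Proof. by rewrite -[x]scale1r lf !scale1r. Qed.
Lemma linf0 : f 0 = 0.
Proof. by apply: (addrI (f 0)); rewrite -linfD !addr0. Qed.
Lemma linfZ c x : f (c *: x) = c *: f x.
Proof. by rewrite -[c *: x]addr0 lf linf0 addr0. Qed.
Lemma linfN x : f (- x) = - f x.
Proof. by rewrite -scaleN1r linfZ scaleN1r. Qed.
Lemma linfB x y : f (x - y) = f x - f y.
Proof. by rewrite linfD linfN. Qed.
Lemma linf_sum I (s : seq I) (Q : pred I) F :
  f (\sum_(i <- s | Q i) F i) = \sum_(i <- s | Q i) f (F i).
Proof. by apply: big_morph => [x y|]; [exact: linfD | exact: linf0]. Qed.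

End LinearMaps.

Lemma linear_id (K : fieldType) (T : lmodType K) : linear (@id T).
Proof. by []. Qed.

Lemma linear_scalefun (K : fieldType) (T Z : lmodType K) (c : K) (f : T -> Z) :
  linear f -> linear (fun x => c *: f x).
Proof. by move=> lf a x y; rewrite lf scalerDr !scalerA mulrC. Qed.

Lemma linear_comp_sub (K : fieldType) (T Z : lmodType K) (f g : T -> Z) :
  linear f -> linear g -> linear (fun x => f x - g x).
Proof. by move=> lf lg; apply: linear_comp_add lf (linear_comp_opp lg). Qed.

Lemma linear_comp_sum (K : fieldType) (T Z : lmodType K) I (s : seq I)
    (f : I -> T -> Z) :
  (forall i, linear (f i)) -> linear (fun x => \sum_(i <- s) f i x).
Proof.
by move=> lf a x y; rewrite scaler_sumr -big_split; apply: eq_bigr => i _; exact: lf.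
Qed.

Section TensorMaps.
Context {K : fieldType}.
Implicit Types U V W : vectType K.

Lemma tens_ext U V (Z : lmodType K) (F G : tens U V -> Z) :
  linear F -> linear G -> (forall u v, F (tpure u v) = G (tpure u v)) ->
  forall A, F A = G A.
Proof.
move=> lF lG FG A; rewrite (tensE A) !linf_sum //; apply: eq_bigr => a _.
by rewrite !linf_sum //; apply: eq_bigr => b _; rewrite !linfZ // FG.
Qed.

(** Coordinates are row vectors, so maps act by multiplication on the right. Bare functions are
    accepted so that [tmap] can be split along sums of operators written as abstractions. *)
Definition vmx U V (f : U -> V) : 'M[K]_(dim U, dim V) :=
  lin1_mx (fun w => v2r (f (r2v w))).

Lemma v2r_vmx U V (f : U -> V) u : linear f -> v2r (f u) = v2r u *m vmx f.
Proof.
move=> lf; rewrite {1}[u]v2r_basis (linf_sum lf) linear_sum /=.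
apply/rowP => b; rewrite summxE mxE; apply: eq_bigr => a _.
by rewrite (linfZ lf) linearZ /= !mxE.
Qed.

(** The map [f ⊗ g]: [f] acts on the row index of the coordinate matrix, [g] on its column index. *)
Definition tmap U V U' V' (f : U -> U') (g : V -> V') (A : tens U V) :
  tens U' V' := (vmx f)^T *m A *m vmx g.

Lemma tmap_linear U V U' V' (f : U -> U') (g : V -> V') : linear (tmap f g).
Proof. by move=> c A B; rewrite /tmap mulmxDr mulmxDl -scalemxAr -scalemxAl. Qed.

Lemma tmap_tpure U V U' V' (f : U -> U') (g : V -> V') u v :
  linear f -> linear g -> tmap f g (tpure u v) = tpure (f u) (g v).
Proof.
by move=> lf lg; rewrite /tpure !v2r_vmx // trmx_mul /tmap !mulmxA.
Qed.

Lemma vmxD U V (f g : U -> V) : vmx (fun x => f x + g x) = vmx f + vmx g.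
Proof. by apply/matrixP => i j; rewrite !mxE linearD mxE. Qed.

Lemma vmxN U V (f : U -> V) : vmx (fun x => - f x) = - vmx f.
Proof. by apply/matrixP => i j; rewrite !mxE linearN mxE. Qed.

Lemma vmxZ U V c (f : U -> V) : vmx (fun x => c *: f x) = c *: vmx f.
Proof. by apply/matrixP => i j; rewrite !mxE linearZ mxE. Qed.

Lemma tmapDl U V U' V' (f f' : U -> U') (g : V -> V') A :
  tmap (fun x => f x + f' x) g A = tmap f g A + tmap f' g A.
Proof. by rewrite /tmap vmxD linearD !mulmxDl. Qed.

Lemma tmapDr U V U' V' (f : U -> U') (g g' : V -> V') A :
  tmap f (fun x => g x + g' x) A = tmap f g A + tmap f g' A.
Proof. by rewrite /tmap vmxD mulmxDr. Qed.

Lemma tmapZl U V U' V' c (f : U -> U') (g : V -> V') A :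
  tmap (fun x => c *: f x) g A = c *: tmap f g A.
Proof. by rewrite /tmap vmxZ linearZ /= -!scalemxAl. Qed.

Lemma tmapZr U V U' V' c (f : U -> U') (g : V -> V') A :
  tmap f (fun x => c *: g x) A = c *: tmap f g A.
Proof. by rewrite /tmap vmxZ -scalemxAr. Qed.

Lemma tmapNr U V U' V' (f : U -> U') (g : V -> V') A :
  tmap f (fun x => - g x) A = - tmap f g A.
Proof. by rewrite /tmap vmxN mulmxN. Qed.

Lemma tflipD U V (A B : tens U V) : tflip (A + B) = tflip A + tflip B.
Proof. exact: linearD. Qed.

Lemma tflipN U V (A : tens U V) : tflip (- A) = - tflip A.
Proof. exact: linearN. Qed.

Lemma tflip0 U V : tflip (0 : tens U V) = 0.
Proof. exact: linear0. Qed.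

Lemma tflip_tmap U V U' V' (f : U -> U') (g : V -> V') A :
  tflip (tmap f g A) = tmap g f (tflip A).
Proof. by rewrite /tflip /tmap !trmx_mul trmxK mulmxA. Qed.

(** Jointly injective families stay jointly injective after tensoring. This lifts the non-degeneracy
    of the form to tensor powers. *)
Lemma tmap0_inj U V U' V' (I J : Type) (f : I -> U -> U') (g : J -> V -> V') A :
  (forall i, linear (f i)) -> (forall j, linear (g j)) ->
  (forall u, (forall i, f i u = 0) -> u = 0) ->
  (forall v, (forall j, g j v = 0) -> v = 0) ->
  (forall i j, tmap (f i) (g j) A = 0) -> A = 0.
Proof.
move=> lf lg f0 g0 fgA.
(* One side of the matrix at a time: each row of [B], read as a vector of [X], is killed by every
   [h l]. Transposition then gives the other side. *)
have rows (X Y : vectType K) (L : Type) (h : L -> X -> Y) m (B : 'M[K]_(m, dim X)) :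
    (forall l, linear (h l)) -> (forall x, (forall l, h l x = 0) -> x = 0) ->
    (forall l, B *m vmx (h l) = 0) -> B = 0.
  move=> lh h0 hB; apply/row_matrixP => k; rewrite row0.
  apply: (can_inj r2vK); rewrite linear0; apply: h0 => l; apply: v2r_inj.
  by rewrite v2r_vmx // r2vK -row_mul hB row0 linear0.
apply: (rows _ _ _ g) => // j; apply: trmx_inj; rewrite trmx0.
apply: (rows _ _ _ f) => // i; apply: trmx_inj.
by rewrite trmx_mul trmxK trmx0 mulmxA; exact: fgA.
Qed.

End TensorMaps.

(** Leaves the linearity of the innermost maps as goals. In a pure tensor the variable may occur in
    one factor only; the second [refine] covers the second factor. *)
Ltac prove_linear :=
  lazymatch goal with
  | |- GRing.linear_for _ (fun x => x) => exact: linear_id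
  | |- GRing.linear_for _ (fun x => tpure (@?f x) (@?g x)) =>
      first [ refine (linear_comp (f := f) ((tpure_bilinear _ _).1 _) _)
            | refine (linear_comp (f := g) ((tpure_bilinear _ _).2 _) _) ]; prove_linear
  | |- GRing.linear_for _ (fun x => @?f x + @?g x) =>
      refine (linear_comp_add (f := f) (g := g) _ _); prove_linear
  | |- GRing.linear_for _ (fun x => - @?f x) =>
      refine (linear_comp_opp (f := f) _); prove_linear
  | |- GRing.linear_for _ (fun x => _ *: @?f x) =>
      refine (linear_scalefun _ (f := f) _); prove_linear
  | _ => idtac
  end.

Section Cdot.
Context {K : fieldType} {L_ : int -> vectType K}.
Variable dot : dsum L_ -> dsum L_ -> dsum L_.
Hypothesis bD : bilinear_op dot.

Lemma cdot_bilinear p q k : bilinear_op (fun (a : L_ p) (b : L_ q) => cdot dot a b k).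
Proof. by split=> w c x y; rewrite /= /cdot dinj_linear ?bD.1 ?bD.2. Qed.

End Cdot.

Lemma tlift_fun0 (K : fieldType) (U V : vectType K) (Z : lmodType K)
    (F : U -> V -> Z) A : (forall u v, F u v = 0) -> tlift F A = 0.
Proof.
by move=> F0; rewrite /tlift big1 // => a _; rewrite big1 // => b _; rewrite F0 scaler0.
Qed.

Lemma fsbigT_single (T : choiceType) (Z : zmodType) (F : T -> Z) (i : T) :
  (forall j, j != i -> F j = 0) -> \sum_(j \in [set: T]%classic) F j = F i.
Proof.
move=> F0; rewrite (@fsbigT_seq _ _ _ [:: i]) ?big_seq1 // => j.
by rewrite inE; exact: F0.
Qed.

Lemma summable_single (T : choiceType) (Z : zmodType) (F : T -> Z) (i : T) :
  (forall j, j != i -> F j = 0) -> summable F.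
Proof.
move=> F0; apply: (sub_finite_set _ (finite_set1 i)) => j /=.
by apply: contra_neqP => /eqP /F0.
Qed.

(** * The canonical element of the form *)

Section Casimir.
Context {K : fieldType} {P : vectType K} {Q_ : int -> vectType K}.
Variables (circ : dsum Q_ -> dsum Q_ -> dsum Q_) (varpi : dsum Q_ -> dsum Q_ -> K).
Hypothesis qP : quadratic_graded_leibniz circ varpi.
Variable m : int.
Hypothesis varpi_graded : forall i j x y,
  homogeneous i x -> homogeneous j y -> i + j + m != 0 -> varpi x y = 0.
Local Notation Q := (dsum Q_).
Local Notation PQ := (PQ (P := P) (Q_ := Q_)).
(** By the grading of the form, [i^!] is the only degree that can pair non-trivially with degree
    [i]. *)
Local Notation "i ^!" := (- m - i) (format "i ^!").

Lemma dualdegK (i : int) : (i^!)^! = i. Proof. by ring. Qed.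

Lemma dualdeg_neq (i j : int) : j != i^! -> i + j + m != 0.
Proof.
apply: contra_neq => ij; have -> : j = (i + j + m) - m - i by ring.
by rewrite ij sub0r.
Qed.

Lemma varpi_l y : linear (varpi^~ y : Q -> K^o).
Proof. exact: (qgl_form_bilinear qP).1. Qed.

Lemma varpi_r x : linear (varpi x : Q -> K^o).
Proof. exact: (qgl_form_bilinear qP).2. Qed.

(** Components of [X] outside degree [i] are orthogonal to [x] by the grading, so projecting [X]
    first loses nothing. By linearity it is enough to test homogeneous [X]. *)
Lemma varpi_proj (i : int) (X x : Q) :
  homogeneous (i^!) x -> varpi (dinj (X i)) x = varpi X x.
Proof.
move=> hx; apply: (@dsum_linear_ext _ _ K^o (fun X : Q => varpi (dinj (X i)) x)
  (varpi^~ x)) => [||k z].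
- by move=> c y z; rewrite -varpi_l -dinj_linear.
- exact: varpi_l.
have [ki|ki] := eqVneq k i.
  by subst k; congr varpi; congr dinj; rewrite /= eqtype.dfwith_in.
rewrite homogeneous_dinjP 1?eq_sym // (linf0 (@dinj_linear _ _ _)).
rewrite [LHS](linf0 (varpi_l x)); apply/esym.
apply: (varpi_graded (homogeneous_dinjP z) hx).
by apply: contra_neq ki => ki; rewrite -[RHS]add0r -ki; ring.
Qed.

(* [s p q] lists the finitely many terms of bidegree [(p, q)] of the formal sum
   [\sum_j e_j ⊗ f_j], the canonical element of the form. *)
Record casimir (s : forall p q, seq (Q_ p * Q_ q)) : Prop := Casimir {
  casimir_out : forall p q, q != p^! -> s p q = [::];
  casimir_id : forall p (x : Q_ p),
    \sum_(t <- s p (p^!)) varpi (dinj x) (dinj t.2) *: t.1 = x }.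

Variable s : forall p q, seq (Q_ p * Q_ q).
Hypothesis sP : casimir s.

Section Contract.
Context {Z : lmodType K}.

(** This is [casimir_id] with the arguments of the form exchanged; the sign comes from
    skew-symmetry. *)
Lemma casimir_contractl (p q : int) (Phi : Q -> Z) y :
  q = p^! -> linear Phi -> homogeneous p y ->
  \sum_(t <- s p q) varpi (dinj t.2) y *: Phi (dinj t.1) = - Phi y.
Proof.
move=> -> lPhi /homogeneous_dinj ->; set x := y p.
rewrite -{2}(casimir_id sP x) (linf_sum (linear_comp lPhi (@dinj_linear _ _ _))).
rewrite -sumrN; apply: eq_bigr => t _; rewrite (linfZ (@dinj_linear _ _ _)).
by rewrite (linfZ lPhi) -scaleNr -(qgl_form_skew qP).
Qed.

(** The expansion along the second legs follows from non-degeneracy: the sum of the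
    [varpi (dinj t.1) y *: dinj t.2] and [y] itself pair equally with every [z]. *)
Lemma casimir_contractr (p q : int) (Phi : Q -> Z) y :
  q = p^! -> linear Phi -> homogeneous q y ->
  \sum_(t <- s p q) varpi (dinj t.1) y *: Phi (dinj t.2) = Phi y.
Proof.
move=> -> lPhi hy; suff yE : \sum_(t <- s p (p^!)) varpi (dinj t.1) y *: dinj t.2 = y.
  by rewrite -[in RHS]yE (linf_sum lPhi); apply: eq_bigr => t _; rewrite (linfZ lPhi).
set X := (X in X = _); have hX : homogeneous (p^!) X.
  rewrite /X; apply: homogeneous_sum => t; apply: homogeneousZ; exact: homogeneous_dinjP.
apply/eqP; rewrite -subr_eq0; apply/eqP; apply: (qgl_form_nondegenerate qP) => z.
rewrite (qgl_form_skew qP) -(@varpi_proj p); last exact: homogeneousB.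
(* Only the degree [p] part [x] of [z] matters; both pairings with [x] reduce to the double
   contraction [E]. *)
set x := z p; pose E := \sum_(t <- s p (p^!))
  varpi (dinj x) (dinj t.2) * varpi (dinj t.1) y.
have xX : varpi (dinj x) X = E.
  rewrite [LHS](linf_sum (varpi_r _)); apply: eq_bigr => t _.
  by rewrite [LHS](linfZ (varpi_r _)) /GRing.scale /= mulrC.
have xy : varpi (dinj x) y = E.
  rewrite -[in LHS](casimir_id sP x) (linf_sum (@dinj_linear _ _ _)).
  rewrite [LHS](linf_sum (varpi_l y)); apply: eq_bigr => t _.
  by rewrite (linfZ (@dinj_linear _ _ _)) [LHS](linfZ (varpi_l y)).
by apply/eqP; rewrite oppr_eq0 [varpi _ _](linfB (varpi_r _)) xX xy subrr.
Qed.

End Contract.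

(** * Contraction of tensors over [P ⊗ Q] to tensors over [P] *)

Definition ev (x : Q) i : PQ i -> P := tlift (fun a (y : Q_ i) => varpi (dinj y) x *: a).

Lemma ev_linear x i : linear (@ev x i).
Proof. exact: tlift_linear. Qed.

Lemma ev_tpure x i a (y : Q_ i) : ev x (tpure a y : PQ i) = varpi (dinj y) x *: a.
Proof.
rewrite /ev tlift_tpure //; split=> [z|b] c u w /=; first by rewrite scalerDr !scalerA mulrC.
by rewrite dinj_linear [X in X *: _]varpi_l scalerDl scalerA.
Qed.

(** The canonical element reconstructs [A] as the sum of the [ev t.2 A ⊗ t.1], so vanishing
    contractions force [A = 0]. *)
Lemma ev_inj (i : int) (A : PQ i) : (forall x : Q_ (i^!), ev (dinj x) A = 0) -> A = 0.
Proof.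
move=> evA; rewrite -[LHS]/(id A).
rewrite [LHS](@tens_ext _ _ _ _ id
  (fun A : PQ i => \sum_(t <- s i (i^!)) tpure (ev (dinj t.2) A) t.1)) //.
- by rewrite big1 // => t _; rewrite evA (bilin0l (tpure_bilinear _ _)).
- apply: linear_comp_sum => t; prove_linear; exact: ev_linear.
move=> a x; rewrite -{1}(casimir_id sP x) (bilin_sumr (tpure_bilinear _ _)).
apply: eq_bigr => t _; rewrite ev_tpure.
by rewrite (bilinZl (tpure_bilinear _ _)) (bilinZr (tpure_bilinear _ _)).
Qed.

Definition ev2 x y i j : tens (PQ i) (PQ j) -> tens P P :=
  tmap (@ev x i) (@ev y j).

Definition ev3 x y z i j k : tens (PQ i) (tens (PQ j) (PQ k)) -> tens P (tens P P) :=
  tmap (@ev x i) (ev2 y z (j := k)).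

Lemma ev2_linear x y i j : linear (@ev2 x y i j).
Proof. exact: tmap_linear. Qed.

Lemma ev3_linear x y z i j k : linear (@ev3 x y z i j k).
Proof. exact: tmap_linear. Qed.

Lemma ev2_tpure x y i j (A : PQ i) (B : PQ j) :
  ev2 x y (tpure A B) = tpure (ev x A) (ev y B).
Proof. by apply: tmap_tpure; exact: ev_linear. Qed.

Lemma ev3_tpure3 x y z i j k (A : PQ i) (B : PQ j) (C : PQ k) :
  ev3 x y z (tpure3 A B C) = tpure3 (ev x A) (ev y B) (ev z C).
Proof.
by rewrite /ev3 tmap_tpure ?ev2_tpure; [| exact: ev_linear | exact: ev2_linear].
Qed.

Lemma ev2_inj (i j : int) (A : tens (PQ i) (PQ j)) :
  (forall x y, homogeneous (i^!) x -> homogeneous (j^!) y -> ev2 x y A = 0) -> A = 0.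
Proof.
move=> evA; apply: (tmap0_inj (f := fun x : Q_ (i^!) => @ev (dinj x) i)
  (g := fun y : Q_ (j^!) => @ev (dinj y) j)).
- by move=> ?; exact: ev_linear.
- by move=> ?; exact: ev_linear.
- exact: ev_inj.
- exact: ev_inj.
by move=> x y; apply: evA; exact: homogeneous_dinjP.
Qed.

(** [tmap0_inj] is used twice: to split off the first factor, with pairs [(y, z)] indexing the
    contractions of the rest, and then to separate the last two factors. *)
Lemma ev3_inj (i j k : int) (A : tens (PQ i) (tens (PQ j) (PQ k))) :
  (forall x y z, homogeneous (i^!) x -> homogeneous (j^!) y ->
     homogeneous (k^!) z -> ev3 x y z A = 0) -> A = 0.
Proof.
move=> evA; apply: (tmap0_inj (f := fun x : Q_ (i^!) => @ev (dinj x) i)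
  (g := fun yz : Q_ (j^!) * Q_ (k^!) => @ev2 (dinj yz.1) (dinj yz.2) j k)).
- by move=> ?; exact: ev_linear.
- by move=> ?; exact: ev2_linear.
- exact: ev_inj.
- move=> B evB; apply: (tmap0_inj (f := fun x : Q_ (j^!) => @ev (dinj x) j)
    (g := fun y : Q_ (k^!) => @ev (dinj y) k)).
  + by move=> ?; exact: ev_linear.
  + by move=> ?; exact: ev_linear.
  + exact: ev_inj.
  + exact: ev_inj.
  + by move=> y z; exact: (evB (y, z)).
by move=> x [y z]; apply: evA; exact: homogeneous_dinjP.
Qed.

(** The canonical element with [R] inserted in its [P]-legs. Taking a tensor rather than a
    decomposition lets the same formula serve [r] and [r + τ(r)]; [r_hat] and [r_hat_W] are both
    instances. *)
Definition casT (R : tens P P) : ctens2 (L_ := PQ) := fun p q =>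
  \sum_(t <- s p q) tmap (fun a => tpure a t.1 : PQ p) (fun b => tpure b t.2 : PQ q) R.

Lemma casT_linear p q : linear (fun R => casT R p q).
Proof. by apply: linear_comp_sum => t; exact: tmap_linear. Qed.

Lemma casT_out R (p q : int) : q != p^! -> casT R p q = 0.
Proof. by move=> pq; rewrite /casT (casimir_out sP) // big_nil. Qed.

Lemma casT_tpure a b p q : casT (tpure a b) p q =
  \sum_(t <- s p q) tpure (tpure a t.1 : PQ p) (tpure b t.2 : PQ q).
Proof. by apply: eq_bigr => t _; rewrite tmap_tpure //; prove_linear. Qed.

(** On a pure tensor the canonical element collapses by [casimir_contractr]. Hence [R] can be read
    off from [casT R] once [ϖ(x, y)] is invertible. *)
Lemma ev2_casT x y (p : int) R : homogeneous (p^!) x -> homogeneous p y ->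
  ev2 x y (casT R p (p^!)) = varpi x y *: R.
Proof.
move=> hx hy; apply: (@tens_ext _ _ _ _ (fun R => ev2 x y (casT R p (p^!)))
   (fun R => varpi x y *: R)).
- exact: linear_comp (@ev2_linear _ _ _ _) (@casT_linear _ _).
- prove_linear.
move=> a b; rewrite casT_tpure (linf_sum (@ev2_linear _ _ _ _)).
under eq_bigr => t _ do rewrite ev2_tpure !ev_tpure
  (bilinZl (tpure_bilinear _ _)) (bilinZr (tpure_bilinear _ _)).
apply: (@casimir_contractr _ _ _ (fun X => varpi X y *: tpure a b) x) => //.
by move=> c X Y; rewrite [X in X *: _]varpi_l scalerDl scalerA.
Qed.

(** The canonical element of a skew form is antisymmetric, so flipping costs a sign. Both sides are
    compared after contraction. *)
Lemma cflip_casT R (p q : int) : cflip (casT R) p q = - casT (tflip R) p q.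
Proof.
have [->|pq] := eqVneq q (p^!); last first.
  rewrite /cflip !casT_out ?oppr0 //; first exact: linear0.
  by apply: contra_neq pq => ->; rewrite dualdegK.
apply/eqP; rewrite -addr_eq0; apply/eqP; apply: ev2_inj => x y hx hy.
rewrite dualdegK in hy.
rewrite (linfD (@ev2_linear _ _ _ _)) ev2_casT //.
rewrite /cflip /ev2 -tflip_tmap -/(ev2 _ _ _).
have := @ev2_casT y x (p^!) R; rewrite dualdegK => -> //.
by rewrite /tflip linearZ /= (qgl_form_skew qP) scaleNr addNr.
Qed.

End Casimir.

(** * The S-equation and invariance *)

Section SEquation.
Context {K : fieldType} {P : vectType K} {Q_ : int -> vectType K}.
Variables (rhd lhd : P -> P -> P).
Hypothesis zdP : zinbiel_dendriform rhd lhd.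
Variables (circ : dsum Q_ -> dsum Q_ -> dsum Q_) (varpi : dsum Q_ -> dsum Q_ -> K).
Hypothesis qP : quadratic_graded_leibniz circ varpi.
Variable m : int.
Hypothesis varpi_graded : forall i j x y,
  homogeneous i x -> homogeneous j y -> i + j + m != 0 -> varpi x y = 0.
Variable s : forall p q, seq (Q_ p * Q_ q).
Hypothesis sP : casimir varpi m s.
Local Notation Q := (dsum Q_).
Local Notation PQ := (PQ (P := P) (Q_ := Q_)).
Local Notation "i ^!" := (- m - i) (format "i ^!").
Local Notation ev := (ev varpi).
Local Notation ev2 := (ev2 varpi).
Local Notation ev3 := (ev3 varpi).
Local Notation dot := (pq_dot rhd lhd circ).
Local Notation cdot := (cdot dot).
Local Notation "x ∗ y" := (zd_star rhd lhd x y) (at level 40, left associativity).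
Local Notation "x ⊖ y" := (zd_ominus rhd lhd x y) (at level 40, left associativity).

Lemma pq_dot_dinj (a b : P) p q (c : Q_ p) (d : Q_ q) :
  dot (dinj (tpure a c : PQ p)) (dinj (tpure b d : PQ q))
  = gpure (rhd a b) (circ (dinj c) (dinj d)) - gpure (lhd b a) (circ (dinj d) (dinj c)).
Proof.
rewrite -!gpure_dinj pq_dot_gpure //;
  [exact: zd_rhd_bilinear zdP | exact: zd_lhd_bilinear zdP | exact: qgl_bilinear qP].
Qed.

(* [id ⊗ ϖ(·, x)] applied to [(a ⊗ X) · (b ⊗ Y)]. *)
Definition evdot x a b X Y : P :=
  varpi (circ X Y) x *: rhd a b - varpi (circ Y X) x *: lhd b a.

Lemma evdot_bilinear x a b : bilinear_op (evdot x a b).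
Proof.
have bC := qgl_bilinear qP.
have lv (f : Q -> Q) c : linear f -> linear (fun X => varpi (f X) x *: c : P).
  by move=> lf k X Y; rewrite lf [X in X *: _](varpi_l qP) scalerDl scalerA.
by split=> w; apply: linear_comp_sub; apply: lv; rewrite ?bC.1 ?bC.2;
  [exact: bC.1 | exact: bC.2 | exact: bC.2 | exact: bC.1].
Qed.

Lemma ev_gpure x i a X : homogeneous (i^!) x ->
  ev x (gpure a X i : PQ i) = varpi X x *: a.
Proof. by move=> hx; rewrite (ev_tpure qP) // (varpi_proj qP varpi_graded). Qed.

Lemma ev_cdot x a b p q i (c : Q_ p) (d : Q_ q) : homogeneous (i^!) x ->
  ev x (cdot (tpure a c : PQ p) (tpure b d : PQ q) i) = evdot x a b (dinj c) (dinj d).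
Proof.
move=> hx; rewrite /cdot pq_dot_dinj.
by rewrite [X in ev x X]/= (linfB (@ev_linear _ _ _ _ _ _)) !ev_gpure.
Qed.

(** Invariance rewrites both sides with [y ∘ z + z ∘ y], which is symmetric in [y] and [z]. *)
Lemma form_swap x y z : varpi (circ x z) y = varpi (circ x y) z.
Proof. by rewrite !(qgl_form_invariant qP) addrC. Qed.

(** Invariance and skew-symmetry turn [ϖ(x ∘ y, z)] into [- ϖ(y ∘ z, x) - ϖ(z ∘ y, x)], and
    [form_swap] reorders the arguments. With [form_swap], every pairing of a product of two of
    [x, y, z] with the third is a combination of [ϖ(x ∘ y, z)] and [ϖ(y ∘ x, z)]. *)
Lemma form_cyclic x y z :
  varpi (circ z x) y = - (varpi (circ x y) z + varpi (circ y x) z).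
Proof.
rewrite [X in - (X + _)](qgl_form_invariant qP) [varpi x _](qgl_form_skew qP).
rewrite [varpi _ x](linfD (varpi_l qP x)) (form_swap y x z) (form_swap z x y).
by rewrite opprD opprK addrAC subrr add0r.
Qed.

Lemma evdot_first a b x y z : evdot x a b y z =
  varpi (circ y x) z *: rhd a b + (varpi (circ x y) z + varpi (circ y x) z) *: lhd b a.
Proof.
by rewrite /evdot (form_swap y x z) (form_swap z x y) (form_cyclic x y z) scaleNr opprK.
Qed.

(** The commutator of the pre-Lie product only sees the sum [∗] of the two products of [P]. *)
Lemma evdot_commutator a b x y z :
  evdot z a b x y - evdot z b a y x =
  varpi (circ x y) z *: (a ∗ b) - varpi (circ y x) z *: (b ∗ a).
Proof.
rewrite /evdot /zd_star !scalerDr !opprD !opprK [X in _ + X = _]addrC addrACA.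
by congr (_ + _); exact: addrC.
Qed.

(** * Invariance of a symmetric tensor as two conditions *)

Section Invariance.
Variable S : tens P P.
Hypothesis S_sym : tflip S = S.
Local Notation onl f := (tmap f id S).
Local Notation onr f := (tmap id f S).

Lemma onl_onr (f : P -> P) : onl f = tflip (onr f).
Proof. by rewrite tflip_tmap S_sym. Qed.

Lemma onr_onl (f : P -> P) : onr f = tflip (onl f).
Proof. by rewrite tflip_tmap S_sym. Qed.

(** This is [(I ⊗ L_∗(a) - L_⊖(a) ⊗ I) S], which will be the coefficient of [ϖ(w ∘ x, y)] in the
    contracted invariance. *)
Definition invA a :=
  onr (rhd a) + onr (lhd a) - (onl (rhd a) + onl (lhd^~ a)).

(** This is [(R_◁(a) ⊗ I + I ⊗ R_∗(a)) S], which will be the coefficient of [- ϖ(x ∘ w, y)]. *)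
Definition invB a := onl (lhd^~ a) + (onr (rhd^~ a) + onr (lhd^~ a)).

(** As [S] is symmetric, the flip of the first invariance expression is [- invA]; the second one is
    [- invA - invB]. *)
Lemma zd_invariantE : zd_invariant rhd lhd S <-> (forall a, invA a = 0 /\ invB a = 0).
Proof.
have bR := zd_rhd_bilinear zdP.
have E1 a : tlift (fun u v => tpure u (a ⊖ v) - tpure (a ∗ u) v) S =
    onr (rhd a) + onr (lhd^~ a) - (onl (rhd a) + onl (lhd a)).
  rewrite -tmapDl -tmapDr; apply: (@tens_ext _ _ _ _ (tlift _)
    (fun S => tmap id (fun v => a ⊖ v) S - tmap (fun u => a ∗ u) id S)).
  - exact: tlift_linear.
  - by apply: linear_comp_sub; exact: tmap_linear.
  have bO := zd_ominus_bilinear zdP; have bS := zd_star_bilinear zdP.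
  move=> u v; rewrite tlift_tpure; last first.
    split=> w; prove_linear; [exact: bS.2 | exact: bO.2].
  rewrite !tmap_tpure //; [exact: bS.2 | exact: bO.2].
have E2 a : tlift (fun u v => tpure (rhd a u) v - tpure u (a ∗ v + v ∗ a)) S =
    onl (rhd a) - (onr (rhd a) + onr (lhd a) + (onr (rhd^~ a) + onr (lhd^~ a))).
  rewrite -!tmapDr; apply: (@tens_ext _ _ _ _ (tlift _)
    (fun S => tmap (rhd a) id S - tmap id (fun v => a ∗ v + v ∗ a) S)).
  - exact: tlift_linear.
  - by apply: linear_comp_sub; exact: tmap_linear.
  have bS := zd_star_bilinear zdP.
  have lS : linear (fun v => a ∗ v + v ∗ a) by exact: linear_comp_add (bS.2 _) (bS.1 _).
  move=> u v; rewrite tlift_tpure; last first.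
    split=> w; prove_linear;
      [exact: bR.2 | exact: bS.2 | exact: bS.1].
  by rewrite !tmap_tpure //; exact: bR.2.
have fl (A B : tens P P) : A = B <-> tflip A = tflip B.
  by split=> [-> //|]; exact: trmx_inj.
have E1' a : tflip (onr (rhd a) + onr (lhd^~ a) - (onl (rhd a) + onl (lhd a))) = - invA a.
  rewrite !(tflipD, tflipN) -!onl_onr -!onr_onl.
  by apply/matrixP => i j; rewrite /invA !mxE; ring.
have E2' a : onl (rhd a) - (onr (rhd a) + onr (lhd a) + (onr (rhd^~ a) + onr (lhd^~ a)))
    = - invA a - invB a.
  apply/matrixP => i j; rewrite /invA /invB !mxE; ring.
rewrite /zd_invariant; split=> [inv a|inv a]; have := inv a; rewrite E1 E2 E2'.
  case=> /fl; rewrite E1' tflip0 => /eqP; rewrite oppr_eq0 => /eqP ->.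
  by rewrite oppr0 sub0r => /eqP; rewrite oppr_eq0 => /eqP ->.
case=> A0 ->; rewrite A0 oppr0 addr0; split=> //; apply/fl.
by rewrite E1' A0 oppr0 tflip0.
Qed.

(** The left-hand side equals [invA + τ(invA) + τ(invB)]. It is the error term of [coefB_tau12]. *)
Lemma invariant_ominus a : zd_invariant rhd lhd S ->
  onl (fun x => x ⊖ a) + onr (lhd a) = 0.
Proof.
rewrite zd_invariantE => inv; have [A0 B0] := inv a.
have : invA a + tflip (invA a) + tflip (invB a) = 0.
  by rewrite A0 B0 !tflip0 !addr0.
rewrite /invA /invB !(tflipD, tflipN) -!onl_onr -!onr_onl => <-.
rewrite [X in X + _](@tmapDl _ _ _ _ _ (rhd^~ a)).
by apply/matrixP => i j; rewrite !mxE; ring.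
Qed.

End Invariance.

Lemma casT_out_l (R : tens P P) (p q : int) : p != q^! -> casT s R p q = 0.
Proof.
by move=> pq; apply: (casT_out sP); apply: contra_neq pq => ->; rewrite dualdegK.
Qed.

(** * The contracted S-equation *)

Section Solution.
Variables (n : nat) (u v : 'I_n -> P).
Let r := \sum_(l < n) tpure (u l) (v l).
Local Notation rhat := (casT s r).

Lemma casT_sum p q : rhat p q = \sum_(l < n) \sum_(t <- s p q)
  tpure (tpure (u l) t.1 : PQ p) (tpure (v l) t.2 : PQ q).
Proof.
rewrite (linf_sum (casT_linear s p q)); apply: eq_bigr => l _.
exact: casT_tpure.
Qed.

Lemma tlift2_casT p q p' q' (Z : lmodType K)
    (F : PQ p -> PQ q -> PQ p' -> PQ q' -> Z) :
  (forall A B, bilinear_op (F A B)) ->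
  (forall A' B', bilinear_op (fun A B => F A B A' B')) ->
  tlift (fun A B => tlift (F A B) (rhat p' q')) (rhat p q) =
  \sum_(l < n) \sum_(l' < n) \sum_(t <- s p q) \sum_(t' <- s p' q')
    F (tpure (u l) t.1) (tpure (v l) t.2) (tpure (u l') t'.1) (tpure (v l') t'.2).
Proof.
move=> bF1 bF2; rewrite (casT_sum p q) tlift_sum; apply: eq_bigr => l _.
rewrite tlift_sum [RHS]exchange_big; apply: eq_bigr => t _ /=.
rewrite tlift_tpure; last first.
  by split=> [B|A]; apply: tlift_fun_linear => A' B';
    [exact: (bF2 _ _).1 | exact: (bF2 _ _).2].
rewrite (casT_sum p' q') tlift_sum; apply: eq_bigr => l' _; rewrite tlift_sum.
by apply: eq_bigr => t' _; rewrite tlift_tpure.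
Qed.

(** The canonical element lives in the bidegrees [(p, p^!)], so a single pair of components
    contributes in each degree. This and the next two lemmas give summability and collapse the
    formal sums. *)
Lemma s_term1213_out i j k pq : pq != (j^!, k^!) -> s_term1213 dot rhat i j k pq = 0.
Proof.
case: pq => p q; rewrite xpair_eqE negb_and /s_term1213 => /orP[] /= pq'.
  by rewrite (casT_out_l _ pq') (linf0 (tlift_linear _)).
by apply: tlift_fun0 => A B; rewrite (casT_out_l _ pq') (linf0 (tlift_linear _)).
Qed.

Lemma s_term1223_out i j k pq : pq != (i^!, k^!) -> s_term1223 dot rhat i j k pq = 0.
Proof.
case: pq => p q; rewrite xpair_eqE negb_and /s_term1223 => /orP[] /= pq'.
  by rewrite (casT_out sP _ pq') (linf0 (tlift_linear _)).
by apply: tlift_fun0 => A B; rewrite (casT_out_l _ pq') (linf0 (tlift_linear _)).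
Qed.

Lemma s_term1323_out i j k pq : pq != (i^!, j^!) -> s_term1323 dot rhat i j k pq = 0.
Proof.
case: pq => p q; rewrite xpair_eqE negb_and /s_term1323 => /orP[] /= pq'.
  by rewrite (casT_out sP _ pq') (linf0 (tlift_linear _)).
by apply: tlift_fun0 => A B; rewrite (casT_out sP _ pq') (linf0 (tlift_linear _)).
Qed.

Section Eval.
Variables (i j k : int) (x y z : Q).
Hypotheses (hx : homogeneous (i^!) x) (hy : homogeneous (j^!) y) (hz : homogeneous (k^!) z).

Lemma tpure3ZZr a b c (h l : K) :
  tpure3 a (h *: b) (l *: c) = h *: (l *: tpure3 a b c) :> tens P (tens P P).
Proof. by rewrite /tpure3 !(bilinZl (tpure_bilinear _ _), bilinZr (tpure_bilinear _ _)). Qed.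

Lemma tpure3ZlZr a b c (h l : K) :
  tpure3 (h *: a) b (l *: c) = h *: (l *: tpure3 a b c) :> tens P (tens P P).
Proof. by rewrite /tpure3 !(bilinZl (tpure_bilinear _ _), bilinZr (tpure_bilinear _ _)). Qed.

Lemma tpure3ZZl a b c (h l : K) :
  tpure3 (h *: a) (l *: b) c = h *: (l *: tpure3 a b c) :> tens P (tens P P).
Proof. by rewrite /tpure3 !(bilinZl (tpure_bilinear _ _), bilinZr (tpure_bilinear _ _)). Qed.

(** The legs left out of the product are contracted. Here both are second legs, paired with [y] and
    [z], and the two signs of [casimir_contractl] cancel. *)
Lemma ev3_term1213 : ev3 x y z (s_term1213 dot rhat i j k (j^!, k^!)) =
  \sum_(l < n) \sum_(l' < n) tpure3 (evdot x (u l) (u l') y z) (v l) (v l').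
Proof.
have bcd p q h := @cdot_bilinear _ _ _ (pq_dot_bilinear rhd lhd circ) p q h.
have bE a b := evdot_bilinear x a b.
rewrite /s_term1213 /= tlift2_casT; last 2 first.
- move=> A B; split=> w; rewrite /tpure3; prove_linear; exact: (bcd _ _ _).2.
- move=> A B; split=> w; rewrite /tpure3; prove_linear; exact: (bcd _ _ _).1.
rewrite (linf_sum (@ev3_linear _ _ _ _ _ _ _ _ _ _)); apply: eq_bigr => l _.
rewrite (linf_sum (@ev3_linear _ _ _ _ _ _ _ _ _ _)); apply: eq_bigr => l' _.
rewrite (linf_sum (@ev3_linear _ _ _ _ _ _ _ _ _ _)).
transitivity (\sum_(t <- s (j^!) j) varpi (dinj t.2) y *:
    - tpure3 (evdot x (u l) (u l') (dinj t.1) z) (v l) (v l')).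
  apply: eq_bigr => t _; rewrite (linf_sum (@ev3_linear _ _ _ _ _ _ _ _ _ _)).
  rewrite -(casimir_contractl qP sP (q := k) (Phi := fun Z =>
    tpure3 (evdot x (u l) (u l') (dinj t.1) Z) (v l) (v l')) (esym (dualdegK _ _)) _ hz).
    rewrite scaler_sumr; apply: eq_bigr => t' _.
    by rewrite ev3_tpure3 // ev_cdot // !(ev_tpure qP) // tpure3ZZr.
  rewrite /tpure3; prove_linear; exact: (bE _ _).2.
rewrite (casimir_contractl qP sP (Phi := fun Y =>
  - tpure3 (evdot x (u l) (u l') Y z) (v l) (v l')) (esym (dualdegK _ _)) _ hy) ?opprK //.
rewrite /tpure3; prove_linear; exact: (bE _ _).1.
Qed.

(** A first leg is paired with [x] and a second leg with [z], so one sign remains. *)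
Lemma ev3_term1223 : ev3 x y z (s_term1223 dot rhat i j k (i^!, k^!)) =
  - \sum_(l < n) \sum_(l' < n) tpure3 (u l) (evdot y (v l) (u l') x z) (v l').
Proof.
have bcd p q h := @cdot_bilinear _ _ _ (pq_dot_bilinear rhd lhd circ) p q h.
have bE a b := evdot_bilinear y a b.
rewrite /s_term1223 /= tlift2_casT; last 2 first.
- move=> A B; split=> w; rewrite /tpure3; prove_linear; exact: (bcd _ _ _).2.
- move=> A B; split=> w; rewrite /tpure3; prove_linear; exact: (bcd _ _ _).1.
rewrite -sumrN (linf_sum (@ev3_linear _ _ _ _ _ _ _ _ _ _)); apply: eq_bigr => l _.
rewrite -sumrN (linf_sum (@ev3_linear _ _ _ _ _ _ _ _ _ _)); apply: eq_bigr => l' _.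
rewrite (linf_sum (@ev3_linear _ _ _ _ _ _ _ _ _ _)).
transitivity (\sum_(t <- s i (i^!)) varpi (dinj t.1) x *:
    - tpure3 (u l) (evdot y (v l) (u l') (dinj t.2) z) (v l')).
  apply: eq_bigr => t _; rewrite (linf_sum (@ev3_linear _ _ _ _ _ _ _ _ _ _)).
  rewrite -(casimir_contractl qP sP (q := k) (Phi := fun Z =>
    tpure3 (u l) (evdot y (v l) (u l') (dinj t.2) Z) (v l')) (esym (dualdegK _ _)) _ hz).
    rewrite scaler_sumr; apply: eq_bigr => t' _.
    by rewrite ev3_tpure3 // ev_cdot // !(ev_tpure qP) // tpure3ZlZr.
  rewrite /tpure3; prove_linear; exact: (bE _ _).2.
rewrite (casimir_contractr qP varpi_graded sP (p := i) (Phi := fun X =>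
  - tpure3 (u l) (evdot y (v l) (u l') X z) (v l')) erefl _ hx) //.
rewrite /tpure3; prove_linear; exact: (bE _ _).1.
Qed.

(** Two first legs are paired with [x] and [y], so no sign appears. *)
Lemma ev3_term1323 : ev3 x y z (s_term1323 dot rhat i j k (i^!, j^!)) =
  \sum_(l < n) \sum_(l' < n)
    tpure3 (u l) (u l') (evdot z (v l) (v l') x y - evdot z (v l') (v l) y x).
Proof.
have bcd p q h := @cdot_bilinear _ _ _ (pq_dot_bilinear rhd lhd circ) p q h.
have bE a b := evdot_bilinear z a b.
rewrite /s_term1323 /= tlift2_casT; last 2 first.
- move=> A B; split=> w; rewrite /tpure3; prove_linear;
    [exact: (bcd _ _ _).2 | exact: (bcd _ _ _).1].
- move=> A B; split=> w; rewrite /tpure3; prove_linear;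
    [exact: (bcd _ _ _).1 | exact: (bcd _ _ _).2].
rewrite (linf_sum (@ev3_linear _ _ _ _ _ _ _ _ _ _)); apply: eq_bigr => l _.
rewrite (linf_sum (@ev3_linear _ _ _ _ _ _ _ _ _ _)); apply: eq_bigr => l' _.
rewrite (linf_sum (@ev3_linear _ _ _ _ _ _ _ _ _ _)).
pose B X Y := evdot z (v l) (v l') X Y - evdot z (v l') (v l) Y X.
transitivity (\sum_(t <- s i (i^!)) varpi (dinj t.1) x *:
    tpure3 (u l) (u l') (B (dinj t.2) y)).
  apply: eq_bigr => t _; rewrite (linf_sum (@ev3_linear _ _ _ _ _ _ _ _ _ _)).
  rewrite -(casimir_contractr qP varpi_graded sP (p := j) (Phi := fun Y =>
    tpure3 (u l) (u l') (B (dinj t.2) Y)) erefl _ hy).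
    rewrite scaler_sumr; apply: eq_bigr => t' _.
    rewrite ev3_tpure3 // (linfB (@ev_linear _ _ _ _ _ _)) !ev_cdot // !(ev_tpure qP) //.
    by rewrite tpure3ZZl.
  rewrite /tpure3 /B; prove_linear; [exact: (bE _ _).2 | exact: (bE _ _).1].
rewrite (casimir_contractr qP varpi_graded sP (p := i) (Phi := fun X =>
  tpure3 (u l) (u l') (B X y)) erefl _ hx) //.
rewrite /tpure3 /B; prove_linear; [exact: (bE _ _).1 | exact: (bE _ _).2].
Qed.
End Eval.

Definition coefA := \sum_(l < n) \sum_(l' < n)
  (tpure3 (u l) (v l ⊖ u l') (v l') - tpure3 (u l) (u l') (v l ∗ v l')
   + tpure3 (lhd (u l) (u l')) (v l') (v l)).

Definition coefB := \sum_(l < n) \sum_(l' < n)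
  (tpure3 (u l ⊖ u l') (v l) (v l') + tpure3 (u l) (lhd (u l') (v l)) (v l')
   + tpure3 (u l) (u l') (v l' ∗ v l)).

Definition s_value i j k := s_term1213 dot rhat i j k (j^!, k^!)
  - s_term1223 dot rhat i j k (i^!, k^!) - s_term1323 dot rhat i j k (i^!, j^!).

Lemma s_solution_value :
  s_solution dot rhat <-> (forall i j k, s_value i j k = 0).
Proof.
have E i j k : \sum_(pq \in [set: int * int]%classic) s_term1213 dot rhat i j k pq
    - \sum_(pq \in [set: int * int]%classic) s_term1223 dot rhat i j k pq
    - \sum_(pq \in [set: int * int]%classic) s_term1323 dot rhat i j k pq
    = s_value i j k.
  rewrite (fsbigT_single (i := (j^!, k^!))); last exact: s_term1213_out.
  rewrite (fsbigT_single (i := (i^!, k^!))); last exact: s_term1223_out.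
  by rewrite (fsbigT_single (i := (i^!, j^!))); last exact: s_term1323_out.
split=> [sol i j k|sol i j k]; first by case: (sol i j k); rewrite E.
split; last by rewrite E; exact: sol.
- by apply: (summable_single (i := (j^!, k^!))); exact: s_term1213_out.
- by apply: (summable_single (i := (i^!, k^!))); exact: s_term1223_out.
- by apply: (summable_single (i := (i^!, j^!))); exact: s_term1323_out.
Qed.

(** All values of the form are reduced to two by [form_swap] and [form_cyclic]; collecting their
    coefficients gives [coefA] and [coefB]. *)
Lemma ev3_s_value i j k x y z :
  homogeneous (i^!) x -> homogeneous (j^!) y -> homogeneous (k^!) z ->
  ev3 x y z (s_value i j k) =
  varpi (circ x y) z *: coefA + varpi (circ y x) z *: coefB.
Proof.
move=> hx hy hz; rewrite /s_value !(linfB (@ev3_linear _ _ _ _ _ _ _ _ _ _)).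
rewrite ev3_term1213 // ev3_term1223 // ev3_term1323 // opprK.
(* Exchanging [l] and [l'] in the [◁] term matches the [lhd b a] of [evdot_first], so the identity
   can be checked summand by summand. *)
have -> : coefA = \sum_(l < n) \sum_(l' < n)
  (tpure3 (u l) (v l ⊖ u l') (v l') - tpure3 (u l) (u l') (v l ∗ v l')
   + tpure3 (lhd (u l') (u l)) (v l) (v l')).
  rewrite /coefA; under eq_bigr => l _ do rewrite big_split /=.
  under [RHS]eq_bigr => l _ do rewrite big_split /=.
  by rewrite !big_split /= [X in _ + X = _]exchange_big.
rewrite /coefB !scaler_sumr -!big_split -sumrN -big_split /=; apply: eq_bigr => l _.
rewrite !scaler_sumr -!big_split -sumrN -big_split /=; apply: eq_bigr => l' _.
rewrite evdot_first evdot_commutator /evdot (form_swap x y z) (form_cyclic x y z).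
rewrite scaleNr opprK /zd_star /zd_ominus.
move: (varpi _ z) (varpi _ z) (tpure_bilinear P (tens P P)) (tpure_bilinear P P).
move=> A B bT3 bT2; rewrite /tpure3 !(bilinDl bT2, bilinDr bT2, bilinDl bT3, bilinDr bT3,
  bilinNl bT2, bilinNr bT2, bilinNl bT3, bilinNr bT3,
  bilinZl bT2, bilinZr bT2, bilinZl bT3, bilinZr bT3).
apply/matrixP => i' j'; rewrite !mxE; ring.
Qed.

Lemma s_solutionP : s_solution dot rhat <->
  (forall i j k x y z,
     homogeneous (i^!) x -> homogeneous (j^!) y -> homogeneous (k^!) z ->
     varpi (circ x y) z *: coefA + varpi (circ y x) z *: coefB = 0).
Proof.
rewrite s_solution_value; split=> [sol i j k x y z hx hy hz|coef0 i j k].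
  by rewrite -(ev3_s_value hx hy hz) sol (linf0 (@ev3_linear _ _ _ _ _ _ _ _ _ _)).
by apply: (ev3_inj qP sP) => x y z hx hy hz; rewrite ev3_s_value //; exact: coef0 hx hy hz.
Qed.

(** The map [τ ⊗ I] on [P ⊗ P ⊗ P]. *)
Definition tau12 : tens P (tens P P) -> tens P (tens P P) :=
  tlift (fun a B => tlift (fun b c => tpure3 b a c) B).

Lemma tau12_tpure3 a b c : tau12 (tpure3 a b c) = tpure3 b a c.
Proof.
rewrite /tau12 /tpure3 tlift_tpure; last first.
  split=> [B|w]; last exact: tlift_linear.
  by apply: tlift_fun_linear => b' c'; prove_linear.
by rewrite tlift_tpure //; split=> w; prove_linear.
Qed.

Definition insert3 (c : P) : tens P P -> tens P (tens P P) :=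
  tlift (fun a b => tpure3 a b c).

Lemma insert3_tpure a b c : insert3 c (tpure a b) = tpure3 a b c.
Proof. by rewrite /insert3 tlift_tpure //; split=> w; rewrite /tpure3; prove_linear. Qed.

(* [coefB] is minus the image of the ZD-YBE under the flip of the first two
   factors, up to terms controlled by the invariance of [r + τ(r)]. *)
Lemma coefB_tau12 : coefB + tau12 coefA =
  \sum_(l' < n) insert3 (v l')
    (tmap (fun x => x ⊖ u l') id (r + tflip r) + tmap id (lhd (u l')) (r + tflip r)).
Proof.
have bL := zd_lhd_bilinear zdP; have bO := zd_ominus_bilinear zdP.
have lt : linear tau12 by exact: tlift_linear.
have li c : linear (insert3 c) by exact: tlift_linear.
have lm (f g : P -> P) : linear (tmap f g) by exact: tmap_linear.
(* With [l'] as outer index, the [∗] terms cancel those of [coefB] and all other terms share the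
   third factor [v l']. *)
have -> : tau12 coefA = \sum_(l' < n) \sum_(l < n)
    (tpure3 (v l ⊖ u l') (u l) (v l') - tpure3 (u l) (u l') (v l' ∗ v l)
     + tpure3 (v l) (lhd (u l') (u l)) (v l')).
  have -> : tau12 coefA = \sum_(l < n) \sum_(l' < n)
     (tpure3 (v l ⊖ u l') (u l) (v l') - tpure3 (u l') (u l) (v l ∗ v l')
      + tpure3 (v l') (lhd (u l) (u l')) (v l)).
    rewrite (linf_sum lt); apply: eq_bigr => l _; rewrite (linf_sum lt).
    apply: eq_bigr => l' _; rewrite !(linfD lt) (linfN lt).
    by rewrite !tau12_tpure3.
  under eq_bigr => l _ do rewrite !big_split /=.
  under [RHS]eq_bigr => l _ do rewrite !big_split /=.
  rewrite !big_split /=; congr (_ + _ + _); exact: exchange_big.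
rewrite /coefB exchange_big -big_split /=; apply: eq_bigr => l' _.
rewrite -big_split /= (linfD (li _)) !(linfD (lm _ _)) !(linfD (li _)).
rewrite /r /tflip linear_sum /= !(linf_sum (lm _ _)) !(linf_sum (li _)) -!big_split /=.
apply: eq_bigr => l _; rewrite -/(tflip _) tflip_tpure.
rewrite !tmap_tpure //; try exact: bO.1; try exact: bL.2.
rewrite !insert3_tpure.
by apply/matrixP => i j; rewrite !mxE; ring.
Qed.

(** Each summand of [coefB_tau12] vanishes by [invariant_ominus] at [u l']. *)
Lemma coefB_eq0 : coefA = 0 -> zd_invariant rhd lhd (r + tflip r) -> coefB = 0.
Proof.
move=> A0 inv; have S_sym : tflip (r + tflip r) = r + tflip r.
  by rewrite tflipD addrC /tflip trmxK.
have := coefB_tau12; rewrite A0 [tau12 0](linf0 (tlift_linear _)) addr0 => ->.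
apply: big1 => l' _; rewrite invariant_ominus //.
exact: (linf0 (tlift_linear _)).
Qed.

Lemma zd_ybe_coefA : zd_ybe rhd lhd r <-> coefA = 0.
Proof. exact: zd_ybeE. Qed.

End Solution.

(** * The contracted invariance condition *)

Section CompletedInvariance.
Variables (S : tens P P) (i j : int).

Definition inv_left X : tens (PQ i) (PQ j) :=
  tlift (fun (A : PQ (j^!)) B => tpure (dot X (dinj A) i) B) (casT s S (j^!) j).

Definition inv_right X : tens (PQ i) (PQ j) :=
  tlift (fun A (B : PQ (i^!)) => tpure A (dot X (dinj B) j - dot (dinj B) X j))
    (casT s S i (i^!)).

(** Again the degrees of the canonical element leave one term in each sum: [p = j^!] in the first,
    [p = i^!] in the second. *)
Lemma inv_sums X :
  \sum_(p \in [set: int]%classic)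
     tlift (fun (A : PQ p) (B : PQ j) => tpure (dot X (dinj A) i) B) (casT s S p j)
  + \sum_(p \in [set: int]%classic)
     tlift (fun (A : PQ i) (B : PQ p) =>
       tpure A (dot X (dinj B) j - dot (dinj B) X j)) (casT s S i p)
  = inv_left X + inv_right X.
Proof.
rewrite (fsbigT_single (i := j^!)) ?(fsbigT_single (i := i^!)) // => p pij.
  by rewrite (casT_out sP) // (linf0 (tlift_linear _)).
by rewrite casT_out_l // (linf0 (tlift_linear _)).
Qed.

Lemma proj_dot_linearl (Y : dsum PQ) k : linear (fun X => dot X Y k).
Proof. by move=> c X X'; rewrite (pq_dot_bilinear _ _ _).1. Qed.

Lemma proj_dot_linearr (X : dsum PQ) p k : linear (fun A : PQ p => dot X (dinj A) k).
Proof.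
move=> c A A'; rewrite dinj_linear.
by rewrite (pq_dot_bilinear _ _ _).2.
Qed.

Lemma proj_dot_linearrl (X : dsum PQ) p k : linear (fun A : PQ p => dot (dinj A) X k).
Proof.
move=> c A A'; rewrite dinj_linear.
by rewrite (pq_dot_bilinear _ _ _).1.
Qed.

Lemma inv_linear : linear (fun X => inv_left X + inv_right X).
Proof.
apply: linear_comp_add; apply: tlift_fun_linear => A B; prove_linear.
- exact: proj_dot_linearl.
- exact: proj_dot_linearl.
by move=> c X X'; rewrite (pq_dot_bilinear _ _ _).2.
Qed.

Section EvalInvariance.
Variables (a : P) (w x y : Q).
Hypotheses (hx : homogeneous (i^!) x) (hy : homogeneous (j^!) y).

Lemma dot_gpure_dinj b p (c : Q_ p) :
  dot (gpure a w) (dinj (tpure b c : PQ p))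
  = gpure (rhd a b) (circ w (dinj c)) - gpure (lhd b a) (circ (dinj c) w).
Proof.
rewrite -!gpure_dinj pq_dot_gpure //;
  [exact: zd_rhd_bilinear zdP | exact: zd_lhd_bilinear zdP | exact: qgl_bilinear qP].
Qed.

Lemma dot_dinj_gpure b p (c : Q_ p) :
  dot (dinj (tpure b c : PQ p)) (gpure a w)
  = gpure (rhd b a) (circ (dinj c) w) - gpure (lhd a b) (circ w (dinj c)).
Proof.
rewrite -!gpure_dinj pq_dot_gpure //;
  [exact: zd_rhd_bilinear zdP | exact: zd_lhd_bilinear zdP | exact: qgl_bilinear qP].
Qed.

Lemma evdot_linear_r z b X Y : linear (fun c => evdot z b c X Y).
Proof.
apply: linear_comp_sub; prove_linear.
  exact: (zd_rhd_bilinear zdP).2.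
exact: (zd_lhd_bilinear zdP).1.
Qed.

Lemma evdot_linear_l z b X Y : linear (fun c => evdot z c b X Y).
Proof.
apply: linear_comp_sub; prove_linear.
  exact: (zd_rhd_bilinear zdP).1.
exact: (zd_lhd_bilinear zdP).2.
Qed.

Lemma ev_dot_gpure b p (c : Q_ p) h z : homogeneous (h^!) z ->
  ev z (dot (gpure a w) (dinj (tpure b c : PQ p)) h) = evdot z a b w (dinj c).
Proof.
move=> hz; rewrite dot_gpure_dinj.
by rewrite [X in ev z X]/= (linfB (@ev_linear _ _ _ _ _ _)) !ev_gpure.
Qed.

Lemma ev_dot_dinj b p (c : Q_ p) h z : homogeneous (h^!) z ->
  ev z (dot (dinj (tpure b c : PQ p)) (gpure a w) h) = evdot z b a (dinj c) w.
Proof.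
move=> hz; rewrite dot_dinj_gpure.
by rewrite [X in ev z X]/= (linfB (@ev_linear _ _ _ _ _ _)) !ev_gpure.
Qed.

(** The untouched second leg is paired with [y], whence the sign; in [ev2_inv_right] it is a first
    leg paired with [x], and there is none. *)
Lemma ev2_inv_left :
  ev2 x y (inv_left (gpure a w)) = - tmap (fun b => evdot x a b w y) id S.
Proof.
have lE := @ev2_linear _ P _ varpi x y i j.
rewrite /inv_left; apply: (@tens_ext _ _ _ _
  (fun R => ev2 x y (tlift _ (casT s R (j^!) j)))
  (fun R => - tmap (fun b => evdot x a b w y) id R)).
- exact: linear_comp lE (linear_comp (tlift_linear _) (casT_linear _ _ _)).
- exact: linear_comp_opp (tmap_linear _ _).
move=> b c; rewrite casT_tpure tlift_sum (linf_sum lE).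
rewrite tmap_tpure //; last exact: evdot_linear_r.
rewrite -(casimir_contractl qP sP (q := j) (Phi := fun Y => tpure (evdot x a b w Y) c)
  (esym (dualdegK _ _)) _ hy); last first.
  prove_linear; exact: (evdot_bilinear _ _ _).2.
apply: eq_bigr => t _; rewrite tlift_tpure; last first.
  split=> z; prove_linear; exact: proj_dot_linearr.
rewrite ev2_tpure ev_dot_gpure // (ev_tpure qP).
by rewrite (bilinZr (tpure_bilinear _ _)).
Qed.

Lemma ev2_inv_right : ev2 x y (inv_right (gpure a w)) =
  tmap id (fun c => evdot y a c w x - evdot y c a x w) S.
Proof.
have lE := @ev2_linear _ P _ varpi x y i j.
have ld : linear (fun c => evdot y a c w x - evdot y c a x w).
  by apply: linear_comp_sub; [exact: evdot_linear_r | exact: evdot_linear_l].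
rewrite /inv_right; apply: (@tens_ext _ _ _ _
  (fun R => ev2 x y (tlift _ (casT s R i (i^!))))
  (fun R => tmap id (fun c => evdot y a c w x - evdot y c a x w) R)).
- exact: linear_comp lE (linear_comp (tlift_linear _) (casT_linear _ _ _)).
- exact: tmap_linear.
move=> b c; rewrite casT_tpure tlift_sum (linf_sum lE) tmap_tpure //.
rewrite -(casimir_contractr qP varpi_graded sP (p := i) (Phi := fun X =>
  tpure b (evdot y a c w X - evdot y c a X w)) erefl _ hx); last first.
  prove_linear; [exact: (evdot_bilinear _ _ _).2 | exact: (evdot_bilinear _ _ _).1].
apply: eq_bigr => t _; rewrite tlift_tpure; last first.
  split=> z; prove_linear; [exact: proj_dot_linearr | exact: proj_dot_linearrl].
rewrite ev2_tpure (linfB (@ev_linear _ _ _ _ _ _)) ev_dot_gpure // ev_dot_dinj //.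
by rewrite (ev_tpure qP) (bilinZl (tpure_bilinear _ _)).
Qed.

Lemma ev2_inv : ev2 x y (inv_left (gpure a w) + inv_right (gpure a w)) =
  varpi (circ w x) y *: invA S a - varpi (circ x w) y *: invB S a.
Proof.
rewrite (linfD (@ev2_linear _ _ _ _ _ _ _ _)) ev2_inv_left ev2_inv_right.
(* Both operators are expressed through [ϖ(w ∘ x, y)] and [ϖ(x ∘ w, y)] before [tmap] is expanded in
   them. *)
have -> : (fun b => evdot x a b w y) = (fun b => varpi (circ w x) y *: rhd a b
    + (varpi (circ w x) y + varpi (circ x w) y) *: lhd b a).
  apply/funext => b; rewrite /evdot (form_swap w x y).
  by rewrite (form_cyclic w x y) scaleNr opprK.
have -> : (fun c => evdot y a c w x - evdot y c a x w) =
    (fun c => varpi (circ w x) y *: (a ∗ c) - varpi (circ x w) y *: (c ∗ a)).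
  by apply/funext => c; rewrite evdot_commutator.
rewrite tmapDl !tmapZl tmapDr tmapNr !tmapZr /zd_star !tmapDr /invA /invB.
by apply/matrixP => k l; rewrite !mxE; ring.
Qed.

End EvalInvariance.

End CompletedInvariance.

Lemma s_invariantP (S : tens P P) : s_invariant dot (casT s S) <->
  (forall a w i j x y, homogeneous (i^!) x -> homogeneous (j^!) y ->
     varpi (circ w x) y *: invA S a - varpi (circ x w) y *: invB S a = 0).
Proof.
split=> [inv a w i j x y hx hy|inv X i j].
  have := inv (gpure a w) i j; rewrite inv_sums => e.
  by rewrite -(ev2_inv _ _ _ hx hy) e (linf0 (@ev2_linear _ _ _ _ _ _ _ _)).
rewrite inv_sums; apply: (@pq_linear_ext _ _ _ _
  (fun X => inv_left S i j X + inv_right S i j X) (fun=> 0)) => [||a w].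
- exact: inv_linear.
- by move=> c Y Z; rewrite scaler0 addr0.
by apply: (ev2_inj qP sP) => x y hx hy; rewrite ev2_inv // (inv a w i j).
Qed.

(** The sign of [cflip_casT] is what turns [r̂ - τ(r̂)] into [r + τ(r)]. *)
Lemma csub_cflip_casT (R : tens P P) :
  csub (casT s R) (cflip (casT s R)) = casT s (R + tflip R).
Proof.
apply: functional_extensionality_dep => p; apply: functional_extensionality_dep => q.
rewrite /csub (cflip_casT qP varpi_graded sP) opprK.
by rewrite (linfD (casT_linear s p q)).
Qed.

Lemma csymmetric_casT (R : tens P P) : skew_symmetric R -> csymmetric (casT s R).
Proof.
move=> skew p q; rewrite (cflip_casT qP varpi_graded sP) skew.
by rewrite (linfN (casT_linear s p q)) opprK.
Qed.

(** Contracting [casT (R + τ(R)) = 0] with a pair of value 1 returns [R + τ(R)]. *)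
Lemma skew_symmetric_casT (R : tens P P) p x y :
  homogeneous (p^!) x -> homogeneous p y -> varpi x y = 1 ->
  csymmetric (casT s R) -> skew_symmetric R.
Proof.
move=> hx hy xy sym; apply/eqP; rewrite -addr_eq0 addrC; apply/eqP.
rewrite -[LHS]scale1r -xy -(ev2_casT qP varpi_graded sP _ hx hy) -csub_cflip_casT.
by rewrite /csub sym subrr (linf0 (@ev2_linear _ _ _ _ _ _ _ _)).
Qed.

Lemma zd_invariant_skew (R : tens P P) :
  skew_symmetric R -> zd_invariant rhd lhd (R + tflip R).
Proof. by move=> ->; rewrite subrr => a; rewrite !(linf0 (tlift_linear _)). Qed.

(** One triple gives both conditions: as it stands it isolates [invA], and with [x] and [y]
    exchanged it isolates [invB]. *)
Lemma zd_invariant_casT (S : tens P P) i j x y z : tflip S = S ->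
  homogeneous (i^!) y -> homogeneous (j^!) z ->
  varpi (circ x y) z = 1 -> varpi (circ y x) z = 0 -> homogeneous (i^!) x ->
  s_invariant dot (casT s S) -> zd_invariant rhd lhd S.
Proof.
move=> S_sym hy hz xyz yxz hx /s_invariantP inv; apply/zd_invariantE => // a; split.
  by have := inv a x i j y z hy hz; rewrite xyz yxz scale1r scale0r subr0.
have := inv a y i j x z hx hz; rewrite xyz yxz scale1r scale0r sub0r.
by move=> /eqP; rewrite oppr_eq0 => /eqP.
Qed.

(** * Passage between the ZD-YBE and the S-equation *)

Section Transfer.
Variables (n : nat) (u v : 'I_n -> P).
Let r := \sum_(l < n) tpure (u l) (v l).

Lemma s_solution_casT : zd_ybe rhd lhd r -> zd_invariant rhd lhd (r + tflip r) ->
  s_solution dot (casT s r).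
Proof.
move=> /zd_ybe_coefA A0 inv; apply/s_solutionP => i j k x y z _ _ _.
by rewrite A0 coefB_eq0 // !scaler0 addr0.
Qed.

Lemma zd_ybe_casT i j k x y z :
  homogeneous (i^!) x -> homogeneous (j^!) y -> homogeneous (k^!) z ->
  varpi (circ x y) z = 1 -> varpi (circ y x) z = 0 ->
  s_solution dot (casT s r) -> zd_ybe rhd lhd r.
Proof.
move=> hx hy hz xyz yxz /s_solutionP sol; apply/zd_ybe_coefA.
by have := sol i j k x y z hx hy hz; rewrite xyz yxz scale1r scale0r addr0.
Qed.

Lemma s_invariant_casT : zd_invariant rhd lhd (r + tflip r) ->
  s_invariant dot (casT s (r + tflip r)).
Proof.
have S_sym : tflip (r + tflip r) = r + tflip r by rewrite tflipD addrC /tflip trmxK.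
move=> /(zd_invariantE S_sym) inv; apply/s_invariantP => a w i j x y _ _.
by have [-> ->] := inv a; rewrite !scaler0 subr0.
Qed.

End Transfer.

End SEquation.

(** * Dual bases and the Laurent case *)

Section DualBases.
Context {K : fieldType} {P : vectType K} {Q_ : int -> vectType K}.
Variables (circ : dsum Q_ -> dsum Q_ -> dsum Q_) (varpi : dsum Q_ -> dsum Q_ -> K).
Hypothesis qP : quadratic_graded_leibniz circ varpi.
Variable m : int.
Hypothesis varpi_graded : forall i j x y,
  homogeneous i x -> homogeneous j y -> i + j + m != 0 -> varpi x y = 0.
Variables (Omega : choiceType) (e f : Omega -> dsum Q_).
Hypotheses (eP : homogeneous_basis e) (fP : homogeneous_basis f).
Hypothesis ef : dual_families varpi e f.
Local Notation Q := (dsum Q_).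
Local Notation "i ^!" := (- m - i) (format "i ^!").

(** Finitely many [e k] suffice to span [Q_p]. Any other [e j] of degree [p] would be a combination
    of them, hence orthogonal to [f j], against [ϖ(e j, f j) = 1]. *)
Lemma homogeneous_basis_support p :
  exists2 t : seq Omega, uniq t & forall j, j \notin t -> e j p = 0.
Proof.
have /fin_all_exists[t tP] (a : 'I_(dim (Q_ p))) : exists t : seq Omega,
    exists c : Omega -> K, dinj (r2v (delta_mx 0 a)) = \sum_(j <- t) c j *: e j.
  exact: hb_span eP _.
exists (undup (flatten [seq t a | a : 'I_(dim (Q_ p))])) => [|j]; first exact: undup_uniq.
rewrite mem_undup => jt; apply/eqP; apply: contraT => ejp.
have [i hi] := hb_homogeneous eP j.
have ip : i = p.
  by apply/eqP; apply: contraNT ejp => ip; rewrite hi // eq_sym.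
subst i; have := ef j j; rewrite eqxx (homogeneous_dinj hi) [e j p]v2r_basis.
rewrite (linf_sum (@dinj_linear _ _ _)) [X in X = _](linf_sum (varpi_l qP _)).
rewrite big1 => [/esym/eqP|a _]; first by rewrite oner_eq0.
rewrite (linfZ (@dinj_linear _ _ _)) [LHS](linfZ (varpi_l qP _)).
have [c ->] := tP a; rewrite [varpi _ _](linf_sum (varpi_l qP _)).
rewrite big1_seq ?scaler0 // => k /= kt.
have kj : k != j.
  apply: contraNneq jt => <-; apply/flattenP; exists (t a) => //.
  by apply/codomP; exists a.
by rewrite [LHS](linfZ (varpi_l qP _)) ef (negPf kj) scaler0.
Qed.

Definition dual_support p : seq Omega := s2val (cid2 (homogeneous_basis_support p)).

Lemma dual_support_uniq p : uniq (dual_support p).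
Proof. exact: s2valP (cid2 (homogeneous_basis_support p)). Qed.

Lemma dual_support_out p j : j \notin dual_support p -> e j p = 0.
Proof. exact: s2valP' (cid2 (homogeneous_basis_support p)) j. Qed.

Definition dual_casimir p q : seq (Q_ p * Q_ q) :=
  if q == p^! then [seq (e j p, f j q) | j <- dual_support p] else [::].

(** By linearity [X] may be replaced by some [e k]. Duality leaves only [j = k], and both sides
    vanish when [k] is outside the list. *)
Lemma dual_expand p (X : Q) : X p = \sum_(j <- dual_support p) varpi X (f j) *: e j p.
Proof.
have [t [c ->]] := hb_span eP X.
have lp : linear (fun Y : Q => Y p) by [].
rewrite (linf_sum lp).
under [RHS]eq_bigr => j _ do rewrite [varpi _ _](linf_sum (varpi_l qP _)) scaler_suml.
rewrite exchange_big; apply: eq_bigr => k _ /=.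
under eq_bigr => j _ do rewrite [varpi _ _](linfZ (varpi_l qP _)) ef -scalerA.
rewrite -scaler_sumr [LHS](linfZ lp (c k)); congr (_ *: _).
have [kt|kt] := boolP (k \in dual_support p); last first.
  rewrite dual_support_out // big1_seq // => j /= jt.
  by rewrite (negPf (_ : k != j)) ?scale0r //; apply: contraNneq kt => ->.
rewrite (bigD1_seq k) ?dual_support_uniq //= eqxx scale1r big1 ?addr0 // => j jk.
by rewrite eq_sym (negPf jk) scale0r.
Qed.

Lemma dual_casimirP : casimir varpi m dual_casimir.
Proof.
split=> [p q pq|p x]; first by rewrite /dual_casimir (negPf pq).
rewrite /dual_casimir eqxx big_map /=.
have {2}-> : x = dinj x p by rewrite /= eqtype.dfwith_in.
rewrite dual_expand; apply: eq_bigr => j _; congr (_ *: _).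
have [i hi] := hb_homogeneous fP j.
(* Truncating [f j] to degree [p^!] is harmless: if its degree differs, its pairing with [x] is
   already zero. *)
have [ip|ip] := eqVneq i (p^!).
  by subst i; rewrite -(homogeneous_dinj hi).
rewrite hi 1?eq_sym // (linf0 (@dinj_linear _ _ _)) [LHS](linf0 (varpi_r qP _)).
by rewrite (varpi_graded (homogeneous_dinjP x) hi) // dualdeg_neq.
Qed.

Lemma r_hat_casT n (u v : 'I_n -> P) :
  r_hat e f u v = casT dual_casimir (\sum_(l < n) tpure (u l) (v l)).
Proof.
apply: functional_extensionality_dep => p; apply: functional_extensionality_dep => q.
rewrite /r_hat (linf_sum (casT_linear _ p q)); apply: eq_bigr => l _.
rewrite casT_tpure /dual_casimir; have bT A B := @tpure_bilinear K A B.
have [->|pq] := eqVneq q (p^!).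
  rewrite big_map /= (fsbigT_seq (dual_support_uniq p)) // => j jp.
  by rewrite /cpure /= dual_support_out // (bilin0r (bT _ _)) (bilin0l (bT _ _)).
rewrite big_nil; apply: fsbig1 => j _; rewrite /cpure /=.
have [i hi] := hb_homogeneous eP j; have [k hk] := hb_homogeneous fP j.
(* Since [ϖ(e j, f j) = 1], the degrees of [e j] and [f j] must be dual. *)
have ik : k = i^!.
  apply/eqP; apply: contraT => ik; have := ef j j.
  rewrite eqxx (varpi_graded hi hk) ?dualdeg_neq // => /esym/eqP.
  by rewrite oner_eq0.
have [pi|pi] := eqVneq p i; last first.
  by rewrite hi // (bilin0r (bT _ _)) (bilin0l (bT _ _)).
by rewrite hk ?(bilin0r (bT _ _)) // ik -pi.
Qed.

End DualBases.

(** * The canonical element of the Laurent algebra *)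

Section LaurentCasimir.
Context {K : fieldType}.
Local Notation eps := (eps K).

Lemma wt_varpi_graded i j (x y : dsum (W_ K)) :
  homogeneous i x -> homogeneous j y -> i + j + 0 != 0 -> wt_varpi x y = 0.
Proof.
move=> /homogeneous_dinj -> /homogeneous_dinj ->; rewrite addr0 => ij.
by rewrite -!/(wt _ _) wt_varpi_wt (negPf ij) mulr0.
Qed.

(** The basis dual to [ε1, ε2, ε3, ε4] is [ε3, ε4, -ε1, -ε2]; the signs are carried by the first
    legs here. *)
Definition laurent_casimir p q : seq (W_ K p * W_ K q) :=
  if q == - p
  then [:: (eps 1, eps 3); (eps 2, eps 4); (- eps 3, eps 1); (- eps 4, eps 2)]
  else [::].

Lemma laurent_casimirP : casimir (@wt_varpi K) 0 laurent_casimir.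
Proof.
split=> [p q|p x]; first by rewrite /laurent_casimir oppr0 sub0r => /negPf ->.
rewrite oppr0 sub0r /laurent_casimir eqxx !big_cons big_nil /= -!/(wt _ _) !wt_varpi_wt.
rewrite subrr eqxx !mulr1 addr0; apply/matrixP => o k; rewrite ord1 !w_nuE /= !mxE.
rewrite !inordK //= -[k in RHS]inord_val.
by case: k => [[|[|[|[|k]]]] k4] //=; ring.
Qed.

Lemma r_hat_W_casT (P : vectType K) n (u v : 'I_n -> P) :
  r_hat_W u v = casT laurent_casimir (\sum_(l < n) tpure (u l) (v l)).
Proof.
apply: functional_extensionality_dep => p; apply: functional_extensionality_dep => q.
have bT A B := @tpure_bilinear K A B.
have cE a (X : dsum (W_ K)) b (Y : dsum (W_ K)) : cpure (gpure a X) (gpure b Y) p q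
    = tpure (tpure a (X p) : PQ p) (tpure b (Y q) : PQ q) by [].
have wt_out (x : W K) i j : i != j -> (wt x i) j = 0.
  by move=> ij; rewrite /wt /= eqtype.dfwith_out.
(* In bidegree [(p, q)] only the power [m = p] contributes. *)
rewrite /r_hat_W (linf_sum (casT_linear _ p q)) (fsbigT_single (i := p)) => [|i ip].
  apply: eq_bigr => l _; rewrite casT_tpure /laurent_casimir.
  have wt_in (x : W K) i : (wt x i) i = x by rewrite /wt /= eqtype.dfwith_in.
  rewrite !cE !wt_in; have [->|qp] := eqVneq q (- p).
    rewrite !wt_in !big_cons big_nil /= addr0 !addrA.
    by rewrite !(bilinNr (bT _ _)) !(bilinNl (bT _ _)).
  rewrite big_nil !(wt_out _ (- p)) 1?eq_sym //.
  by rewrite !(bilin0r (bT _ _)) !subr0 addr0.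
apply: big1 => l _; rewrite !cE !(wt_out _ i) //.
by rewrite !(bilin0r (bT _ _)) !(bilin0l (bT _ _)) !subr0 addr0.
Qed.

End LaurentCasimir.

Theorem theorem3p22 (K : fieldType) (P : vectType K) (rhd lhd : P -> P -> P)
    (HP : zinbiel_dendriform rhd lhd) :
  (forall (Q_ : int -> vectType K) (circ : dsum Q_ -> dsum Q_ -> dsum Q_)
      (varpi : dsum Q_ -> dsum Q_ -> K),
    quadratic_graded_leibniz circ varpi ->
    forall (Omega : choiceType) (e f : Omega -> dsum Q_),
    homogeneous_basis e -> homogeneous_basis f -> dual_families varpi e f ->
    forall (n : nat) (u v : 'I_n -> P),
    let r : tens P P := \sum_(i < n) tpure (u i) (v i) in
    let dot := pq_dot rhd lhd circ in
    let rhat := r_hat e f u v in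
    (zd_ybe rhd lhd r -> zd_invariant rhd lhd (r + tflip r) ->
       s_solution dot rhat /\ s_invariant dot (csub rhat (cflip rhat)))
    /\ (zd_ybe rhd lhd r -> skew_symmetric r ->
       s_solution dot rhat /\ csymmetric rhat))
  /\
  (forall (n : nat) (u v : 'I_n -> P),
    let r : tens P P := \sum_(i < n) tpure (u i) (v i) in
    let dot := pq_dot rhd lhd (@wt_circ K) in
    let rhat := r_hat_W u v in
    (s_solution dot rhat /\ s_invariant dot (csub rhat (cflip rhat)) <->
       zd_ybe rhd lhd r /\ zd_invariant rhd lhd (r + tflip r))
    /\ (s_solution dot rhat /\ csymmetric rhat <->
       zd_ybe rhd lhd r /\ skew_symmetric r)).
Proof.
split=> [Q_ circ varpi qP Omega e f eP fP ef n u v r dot rhat|n u v r dot rhat].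
  have [m gr] := qgl_form_graded qP.
  have sP := dual_casimirP qP gr eP fP ef.
  have -> : rhat = casT _ r := r_hat_casT qP gr eP fP ef u v.
  split=> [ybe inv|ybe skew].
    split; first exact: (s_solution_casT HP qP gr sP).
    by rewrite (csub_cflip_casT qP gr sP); exact: (s_invariant_casT HP qP gr sP).
  have inv := zd_invariant_skew rhd lhd skew.
  by split; [exact: (s_solution_casT HP qP gr sP) | exact: (csymmetric_casT qP gr sP)].
have qP := wt_quadratic K; have gr := @wt_varpi_graded K; have sP := @laurent_casimirP K.
have -> : rhat = casT _ r := r_hat_W_casT u v.
(* All witnesses are taken at [t^0]; [- 0 - 0] is the degree dual to 0 for a form of degree 0. *)
have hwt (x : W K) : homogeneous (- 0 - 0) (wt x 0).
  by rewrite subr0 oppr0; exact: homogeneous_dinjP.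
(* As [ε2 ∘ ε1 = ε1], [ε1 ∘ ε2 = 0] and [ν(ε1, ε3) = 1], the triple [ε2, ε1, ε3] realises the
   coefficients [(1, 0)]. *)
have xyz : wt_varpi (wt_circ (wt (eps K 2) 0) (wt (eps K 1) 0)) (wt (eps K 3) 0) = 1.
  by rewrite wt_circ_wt wt_varpi_wt w_circ_eps // w_nu_eps // !addr0 eqxx mulr1.
have yxz : wt_varpi (wt_circ (wt (eps K 1) 0) (wt (eps K 2) 0)) (wt (eps K 3) 0) = 0.
  rewrite wt_circ_wt wt_varpi_wt w_circ_eps //= w_nuE /= !mxE; ring.
have xz : wt_varpi (wt (eps K 1) 0) (wt (eps K 3) 0) = 1.
  by rewrite wt_varpi_wt w_nu_eps // addr0 eqxx mulr1.
have S_sym : tflip (r + tflip r) = r + tflip r by rewrite tflipD addrC /tflip trmxK.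
have ybe_of : s_solution dot (casT laurent_casimir r) -> zd_ybe rhd lhd r.
  exact: (zd_ybe_casT HP qP gr sP (hwt _) (hwt _) (hwt _) xyz yxz).
split; split=> -[].
- rewrite (csub_cflip_casT qP gr sP) => sol inv; split; first exact: ybe_of.
  exact: (zd_invariant_casT HP qP gr sP S_sym (hwt _) (hwt _) xyz yxz (hwt _)).
- move=> ybe inv; split; first exact: (s_solution_casT HP qP gr sP).
  by rewrite (csub_cflip_casT qP gr sP); exact: (s_invariant_casT HP qP gr sP).
- move=> sol sym; split; first exact: ybe_of.
  exact: (skew_symmetric_casT qP gr sP (hwt _) (homogeneous_dinjP _) xz).
move=> ybe skew; have inv := zd_invariant_skew rhd lhd skew.
by split; [exact: (s_solution_casT HP qP gr sP) | exact: (csymmetric_casT qP gr sP)].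
Qed.
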